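(* Let $s,t\ge0$ be integers, $k=s+t\geq 1$, $\Lambda=s\Lambda_0+t\Lambda_1$, and let $L\ge1$ be an integer. Put $\epsilon^{(L)}=0$ if $L$ is even, $\epsilon^{(L)}=1$ if $L$ is odd, and $\Lambda^{(i)}=i\Lambda_0+(k-i)\Lambda_1$ for $0\le i\le k$. Then $$\mathrm{ch}_L^+(\Lambda)=\sum_{i=0}^s z^{-\epsilon^{(L)}(s-i)}\,q^{\frac{L+\epsilon^{(L)}}2(s-i)}\,\mathrm{ch}_{L-1}(\Lambda^{(i)}),$$ $$\mathrm{ch}_L^-(\Lambda)=\sum_{i=0}^t z^{\epsilon^{(L)}(t-i)}\,q^{\frac{L-\epsilon^{(L)}}2(t-i)}\,\mathrm{ch}_{L-1}(\Lambda^{(k-i)}).$$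
   Context: (1) Path characters $\mathrm{ch}_L(\Lambda)$. $\Lambda_0,\Lambda_1$ are the fundamental weights of $\widehat{sl}(2)$, $\delta$ the null root, $\alpha_1=2\Lambda_1-2\Lambda_0$, $\alpha_0=\delta-\alpha_1$; extend the index by $\Lambda_i=\Lambda_{i'}$ for $i\equiv i' \pmod 2$. Put $\widehat 0=\Lambda_1-\Lambda_0$, $\widehat 1=\Lambda_0-\Lambda_1$, $P_k=\{a_0\Lambda_0+a_1\Lambda_1\mid a_0,a_1\in\mathbb Z,\ a_0+a_1=k\}$. For $\Lambda=s\Lambda_0+t\Lambda_1$ ($k=s+t$) and $L\ge0$, $\mathcal P_L(\Lambda)$ is the set of sequences $p=(p_0,\dots,p_{L+1})$ with all $p_i\in P_k$, $p_{i+1}-p_i=m_i\widehat0+(k-m_i)\widehat1$ for some $m_i\in\{0,\dots,k\}$ ($0\le i\le L$), and $p_i=s\Lambda_i+t\Lambda_{i+1}$ for $i=L,L+1$. Write $\mu_i(p)=m_i$. The ground-state path is $\bar p_i=s\Lambda_i+t\Lambda_{i+1}$ ($0\le i\le L+1$). The energy is $E(p)=\sum_{j=1}^L j\bigl(\max(k-\mu_{j-1}(p),\mu_j(p))-\max(k-\mu_{j-1}(\bar p),\mu_j(\bar p))\bigr)$. Then $\mathrm{ch}_L(\Lambda)=\mathrm{ch}_L(\Lambda)(z,q)=\sum_{p\in\mathcal P_L(\Lambda)}z^{(\Lambda-p_0\mid\Lambda_1)}q^{E(p)}$, where $p_0=\Lambda+j\alpha_1$ for some $j\in\mathbb Z$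 and then $(\Lambda-p_0\mid\Lambda_1)=-j$. (2) The crystal $B(\Lambda)$. An extended Young diagram of charge $\gamma\in\{0,1\}$ is a sequence $Y=(y_j)_{j\ge0}$ of integers with $y_j\le y_{j+1}$ for all $j$ and $y_j=\gamma$ for all large $j$. Its concave corners are the points $(m,y_m)$ with $m=0$ or ($m\ge1$ and $y_{m-1}<y_m$); its convex corners are the points $(m,y_{m-1})$ with $m\ge1$, $y_{m-1}<y_m$. A corner $(m,n)$ is $d$-diagonal with $d=m+n$; it is an $i$-corner if $d\equiv i\pmod2$. Adding a node at a concave corner $(m,y_m)$ means replacing $y_m$ by $y_m-1$; removing is the inverse. Nodes of $Y$ are the pairs $(j,n)$ with $j\ge0$, $y_j<n\le\gamma$, of color $(j+n)\bmod 2$. Let $\mathcal Y(\Lambda)$ be the set of $k$-tuples $\mathbf Y=(Y_1,\dots,Y_k)$ with $Y_j$ of charge $0$ for $j\le s$ and charge $1$ for $j>s$; $\mathrm{wt}\,\mathbf Y=\Lambda-k_0\alpha_0-k_1\alpha_1$ where $k_i$ is the total number of nodes of color $i$. Order $\mathbb Z\times\{1,\dots,k\}$ by $(d,j)>(d',j')$ iff $d>d'$, or $d=d'$ and $j<j'$. The $i$-signature of $\mathbf Y$ lists all $i$-corners of all $Y_j$ (indexed by $(d,j)$) in decreasing order, writing $0$ for concave and $1$ for convex. Repeatedly delete adjacent pairs $(0,1)$ until none is left; the remaining (''relevant'') entries form $1\cdots10\cdots0$. $\tilde f_i\mathbf Y$ is obtained by changing the leftmost relevant $0$ to $1$ (adding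 the node at that corner; $\tilde f_i\mathbf Y=0$ if there is none); $\tilde e_i\mathbf Y$ by changing the rightmost relevant $1$ to $0$ (removing the node; $0$ if there is none). With $\Phi$ the tuple of empty (constant) diagrams, $B(\Lambda)=\{\tilde f_{i_1}\cdots\tilde f_{i_n}\Phi\mid n\ge0\}\setminus\{0\}$, the crystal of the integrable highest weight $U_q(\widehat{sl}(2))$-module $V(\Lambda)$. $B(\Lambda)$ is identified, preserving weights, with the set of all paths $\bigcup_L\mathcal P_L(\Lambda)$ (shorter paths being extended by the ground-state path), the weight of a path $p$ being $p_0-E(p)\delta$. (3) Demazure characters. Let $W=\langle r_0,r_1\rangle$ be the Weyl group (infinite dihedral) with Bruhat order $\prec$; $w_L^+=\cdots r_0r_1r_0$ and $w_L^-=\cdots r_1r_0r_1$ ($L$ factors, rightmost factor $r_0$, resp. $r_1$). Demazure crystals (of the Demazure modules $E_w(\Lambda)$) are given by $B_{\mathrm{id}}(\Lambda)=\{\Phi\}$ and, whenever $r_iw\prec w$, $B_w(\Lambda)=\{\tilde f_i^mb\mid m\ge0,\ b\in B_{r_iw}(\Lambda),\ \tilde e_ib=0\}\setminus\{0\}$. Define $\mathrm{ch}_L^\pm(\Lambda)=\mathrm{ch}^{\pm}_L(\Lambda)(z,q)=\sum_{p\in B_{w_L^\pm}(\Lambda)}z^{(\Lambda-p_0\mid\Lambda_1)}q^{E(p)}$, where $B_{w_L^\pm}(\Lambda)\subseteq B(\Lambda)$ is regarded as a set of paths via the weight-preserving identification of $B(\Lambda)$ with the set of all paths $\bigcup_{L'\ge0}\mathcal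 P_{L'}(\Lambda)$ (a path $p$ having weight $p_0-E(p)\delta$); equivalently an element of weight $\Lambda-k_0\alpha_0-k_1\alpha_1$ contributes $z^{k_1-k_0}q^{k_0}$ (so $e^{-\alpha_1}=z$, $e^{-\delta}=q$). *)

(* Defs.v *)
(* MathComp, with finitely supported sums over classical sets (fsbigop). *)
From HB Require Import structures.
From mathcomp Require Import all_boot all_order all_algebra.
From mathcomp Require Import boolp classical_sets functions cardinality fsbigop.

Set Implicit Arguments.
Unset Strict Implicit.
Unset Printing Implicit Defensive.

Import Order.TTheory GRing.Theory Num.Theory.

Local Open Scope classical_set_scope.
Local Open Scope ring_scope.

(* A dominant weight s Lambda_0 + t Lambda_1 (s, t >= 0) is the pair (s, t) of
   naturals; an element a_0 Lambda_0 + a_1 Lambda_1 (a_0, a_1 integers) is the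
   pair (a_0, a_1). Colors are booleans: false is 0 and true is 1. *)
Definition domweight : Type := (nat * nat)%type.
Definition weight : Type := (int * int)%type.

Definition level (Lam : domweight) : nat := (Lam.1 + Lam.2)%N.

(* ------------------------------- Paths --------------------------------- *)

Definition fund (i : nat) : weight := if odd i then (0, 1) else (1, 0).

Definition hat0 : weight := fund 1 - fund 0.
Definition hat1 : weight := fund 0 - fund 1.

Definition step (k m : nat) : weight := hat0 *+ m + hat1 *+ (k - m).

Definition ground (Lam : domweight) (i : nat) : weight :=
  fund i *+ Lam.1 + fund i.+1 *+ Lam.2.

Definition Pk (k : nat) (a : weight) : Prop := a.1 + a.2 = k%:Z.

Definition paths (L : nat) (Lam : domweight) : set (L.+2.-tuple weight) :=
  [set p | [/\ forall i, (i <= L.+1)%N -> Pk (level Lam) p`_i,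
               forall i, (i <= L)%N -> exists2 m, (m <= level Lam)%N &
                                 p`_i.+1 - p`_i = step (level Lam) m,
               p`_L = ground Lam L &
               p`_L.+1 = ground Lam L.+1]].

(* mu_i(p): the m <= k (unique when k > 0) with p_(i+1) - p_i = step k m. *)
Definition mu (k : nat) (p : nat -> weight) (i : nat) : nat :=
  if [pick m : 'I_k.+1 | p i.+1 - p i == step k m] is Some m then m else 0%N.

Definition localH (k : nat) (p : nat -> weight) (j : nat) : nat :=
  maxn (k - mu k p j.-1) (mu k p j).

Definition energy (L : nat) (Lam : domweight) (p : nat -> weight) : int :=
  \sum_(1 <= j < L.+1)
     j%:Z * ((localH (level Lam) p j)%:Z
             - (localH (level Lam) (ground Lam) j)%:Z).

(* (a_0 Lambda_0 + a_1 Lambda_1 | Lambda_1) = a_1 / 2 for the normalized form.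
   It is only applied to Lambda - p_0, an integer multiple of
   alpha_1 = 2 Lambda_1 - 2 Lambda_0, so the division is exact. *)
Definition pairL1 (a : weight) : int := (a.2 %/ 2)%Z.

(* Characters are Laurent polynomials in z and q with integer coefficients.
   They are represented by their values at all pairs of units (z, q) of all
   commutative rings; equality of these values for every ring and every pair
   of units is equality in Z[z, z^-1, q, q^-1]. *)
Definition ch (R : comUnitRingType) (z q : R) (L : nat) (Lam : domweight) : R :=
  \sum_(p \in @paths L Lam)
     z ^ pairL1 (ground Lam 0 - p`_0) * q ^ energy L Lam (nth 0 p).

(* ----------------------- Extended Young diagrams ----------------------- *)

(* The diagram (y_j)_{j >= 0} of charge g is stored as the list of its entries
   smaller than g: as y is nondecreasing and eventually equal to g, these are
   y_0, ..., y_(n-1) for some n, and y_j = g for j >= n. *)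
Definition eyd : Type := seq int.

Definition entry (g : int) (y : eyd) (m : nat) : int := nth g y m.

(* Replace y_m by v, then drop the entries that have become equal to g. *)
Definition set_entry (g : int) (y : eyd) (m : nat) (v : int) : eyd :=
  [seq x <- set_nth g y m v | x < g].

(* A corner is ((m, n), b), with b = true for a convex and b = false for a
   concave corner. All m > size y are omitted since there y_(m-1) = y_m = g. *)
Definition corners (g : int) (y : eyd) : seq (nat * int * bool) :=
  [seq (m, entry g y m, false) | m <- iota 0 (size y).+1
     & (m == 0%N) || (entry g y m.-1 < entry g y m)]
  ++ [seq (m, entry g y m.-1, true) | m <- iota 1 (size y)
     & entry g y m.-1 < entry g y m].

Definition nodes (g : int) (y : eyd) : seq (nat * int) :=
  [seq (m, g - l%:Z) | m <- iota 0 (size y), l <- iota 0 `|g - entry g y m|%N].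

Definition color (d : int) : bool := odd `|d|%N.

(* ----------------------------- The crystal ----------------------------- *)

Section Crystal.
Variable Lam : domweight.
Let k := level Lam.

(* Components are numbered from 0, so Y_0, ..., Y_(s-1) have charge 0. *)
Definition charge (j : 'I_k) : int := if (j < Lam.1)%N then 0 else 1.

Definition eydtuple : Type := {ffun 'I_k -> eyd}.

Definition Phi : eydtuple := [ffun => [::]].

Definition ncolor (i : bool) (Y : eydtuple) : nat :=
  \sum_(j < k) count (fun x : nat * int => color (x.1%:Z + x.2) == i)
                     (nodes (charge j) (Y j)).

Definition tcorner : Type := ('I_k * (nat * int * bool))%type.
Definition tc_comp (c : tcorner) : 'I_k := c.1.
Definition tc_row (c : tcorner) : nat := c.2.1.1.
Definition tc_val (c : tcorner) : int := c.2.1.2.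
Definition tc_convex (c : tcorner) : bool := c.2.2.
Definition tc_diag (c : tcorner) : int := (tc_row c)%:Z + tc_val c.

Definition tc_geq (c c' : tcorner) : bool :=
  (tc_diag c' < tc_diag c)
  || ((tc_diag c == tc_diag c') && (tc_comp c <= tc_comp c')%N).

Definition signature (i : bool) (Y : eydtuple) : seq tcorner :=
  sort tc_geq
    [seq c <- [seq (j, c) | j <- enum 'I_k, c <- corners (charge j) (Y j)]
       | color (tc_diag c) == i].

(* Delete the leftmost adjacent pair (0, 1) = (concave, convex), if any. *)
Fixpoint cancel1 (s : seq tcorner) : seq tcorner :=
  match s with
  | a :: ((b :: s'') as s') =>
      if ~~ tc_convex a && tc_convex b then s'' else a :: cancel1 s'
  | _ => s
  end.

Definition relevant (i : bool) (Y : eydtuple) : seq tcorner :=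
  let s := signature i Y in iter (size s) cancel1 s.

Definition set_comp (Y : eydtuple) (j : 'I_k) (m : nat) (v : int) : eydtuple :=
  [ffun l => if l == j then set_entry (charge j) (Y j) m v else Y l].

(* Kashiwara operators, None standing for 0. The node at a convex corner
   (m, y_(m-1)) lies in row m - 1. *)
Definition ftilde (i : bool) (Y : eydtuple) : option eydtuple :=
  if ohead [seq c <- relevant i Y | ~~ tc_convex c] is Some c
  then Some (set_comp Y (tc_comp c) (tc_row c) (tc_val c - 1)) else None.

Definition etilde (i : bool) (Y : eydtuple) : option eydtuple :=
  if ohead (rev [seq c <- relevant i Y | tc_convex c]) is Some c
  then Some (set_comp Y (tc_comp c) (tc_row c).-1 (tc_val c + 1)) else None.

Definition ftilde_iter (i : bool) (m : nat) (Y : eydtuple) : option eydtuple :=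
  iter m (obind (ftilde i)) (Some Y).

End Crystal.

(* ------------------------- Demazure characters -------------------------- *)

(* An element of the infinite dihedral group W = <r_0, r_1 | r_i^2> is given by
   its unique reduced word, an alternating sequence of colors. *)
Definition weyl : Type := seq bool.

(* Left multiplication by r_i. *)
Definition rmul (i : bool) (w : weyl) : weyl :=
  if w is j :: w' then if i == j then w' else i :: w else [:: i].

(* Strict Bruhat order, by the subword property; an element of W has only one
   reduced word. *)
Definition bruhat (u w : weyl) : bool := (u != w) && subseq u w.

Fixpoint wplus (L : nat) : weyl :=
  if L is L'.+1 then rmul (odd L') (wplus L') else [::].

Fixpoint wminus (L : nat) : weyl :=
  if L is L'.+1 then rmul (~~ odd L') (wminus L') else [::].

Inductive demazure (Lam : domweight) : weyl -> eydtuple Lam -> Prop :=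
| demazure_id : demazure [::] (Phi Lam)
| demazure_step (i : bool) (w : weyl) (m : nat) (b Y : eydtuple Lam) :
    bruhat (rmul i w) w -> demazure (rmul i w) b -> etilde i b = None ->
    ftilde_iter i m b = Some Y -> demazure w Y.

(* An element of weight Lambda - k_0 alpha_0 - k_1 alpha_1 corresponds to a
   path p with (Lambda - p_0 | Lambda_1) = k_1 - k_0 and E(p) = k_0. *)
Definition ch_dem (R : comUnitRingType) (z q : R) (w : weyl) (Lam : domweight)
    : R :=
  \sum_(Y \in [set Y : eydtuple Lam | demazure w Y])
     z ^ ((ncolor true Y)%:Z - (ncolor false Y)%:Z) * q ^ (ncolor false Y)%:Z.

Definition ch_plus (R : comUnitRingType) (z q : R) (L : nat) (Lam : domweight) :=
  ch_dem z q (wplus L) Lam.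

Definition ch_minus (R : comUnitRingType) (z q : R) (L : nat) (Lam : domweight) :=
  ch_dem z q (wminus L) Lam.

Definition eps (L : nat) : nat := odd L.

Definition LamI (k i : nat) : domweight := (i, (k - i)%N).

(* Main.v *)
(* Number the components of a tuple Y from 0 and extend them to all integers l by
   y^(l+k)_j = y^l_j + 2.  On the tuples that matter, row j is nondecreasing in l,
   so it is determined by the integers u_j(v) with
     y^l_j <= v  <->  l < u_j(v),   where u_j(v+2) = u_j(v) + k,
   that is, by the pair u_j(0), u_j(1).  A color-i move acts, in every row, on only
   one of these two entries, and the entries of the other kind confine it to an
   interval.  The intervals of successive rows are disjoint and ordered, so the
   i-signature is the concatenation, for decreasing j, of words 1^a 0^b, where a
   and b are the distances of the moving entry of row j to the ends of its
   interval.  This is a tensor product of sl(2)-strings, in which one checks that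
   the tuples of B(Lambda) are those whose consecutive rows j, j+1 agree in u(0) or
   in u(1), and that the Demazure set of the alternating word of length L starting
   with i consists of those for which the color-i entries are trivial in the rows
   >= L, and the other entries in the rows >= L - 1.

   Such a tuple is determined by the sequence delta_j = u_j(1) - u_j(0), which is an
   arbitrary sequence in [0, k] with delta_j = t for j >= L and a one-sided bound on
   delta_(L-1).  The steps of the path with the same weight are m_j = delta_j (j odd)
   and m_j = k - delta_j (j even), and u_j - u_(j+1) produces the local energies
   max(k - m_j, m_(j+1)).  Splitting the sum according to delta_(L-1) gives the
   theorem. *)
Require Import Defs.
From mathcomp Require Import all_boot all_order all_algebra.
From mathcomp Require Import boolp classical_sets functions cardinality fsbigop.
From mathcomp Require Import zify ring.
Import Order.TTheory GRing.Theory Num.Theory.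
Local Open Scope ring_scope.

Set Implicit Arguments.
Unset Strict Implicit.
Unset Printing Implicit Defensive.

(** * Row states and the moves on them *)

(* [x b j] is u_j(b), with [b] read as 0 or 1. *)
Definition state : Type := bool -> nat -> int.

(* In row [j] a color-[i] move acts on the entry [x (vcol i j) j]: a node of row [j]
   lowering the value v to v - 1 has color v + j, and it raises u_j(v - 1). *)
Definition vcol (i : bool) (j : nat) : bool := ~~ (i (+) odd j).

Lemma vcolN i j : vcol (~~ i) j = ~~ vcol i j.
Proof. by rewrite /vcol; lia. Qed.

Lemma vcolS i j : vcol i j.+1 = ~~ vcol i j.
Proof. by rewrite /vcol /=; lia. Qed.

Definition shift_entry (d : int) (c : bool) (j : nat) (x : state) : state :=
  fun b n => if (b == c) && (n == j) then x b n + d else x b n.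

Section States.
Variables s t : nat.
Let k : nat := (s + t)%N.

(** The entries of every row of the empty tuple: the [s] components of charge 0 satisfy y <= 0, and
    all [k] satisfy y <= 1. *)
Definition gnd (b : bool) : int := if b then k%:Z else s%:Z.

(* With v the value of parity [c], [prv] is u_j(v - 1) and [nxt] is u_j(v + 1), for
   the representative v = [c]; [lo] and [hi] bound the positions that u_j(v) can take
   without spoiling the monotonicity along the row and between rows. *)
Definition prv (x : state) (c : bool) (j : nat) : int :=
  if c then x false j else x true j - k%:Z.

Definition nxt (x : state) (c : bool) (j : nat) : int := prv x c j + k%:Z.

Definition lo (x : state) (c : bool) (j : nat) : int :=
  Num.max (prv x c j) (x c j.+1).

Definition hi (x : state) (c : bool) (j : nat) : int :=
  if j is j'.+1 then Num.min (nxt x c j) (x c j') else nxt x c j.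

Definition nones i x j : nat := `|x (vcol i j) j - lo x (vcol i j) j|%N.
Definition nzeros i x j : nat := `|hi x (vcol i j) j - x (vcol i j) j|%N.

(* After cancellation, the rows below [n] leave [excess i x n] ones; the leftmost
   relevant 0 lies in row [frow i x n], and the rightmost relevant 1 in row
   [erow i x n]. *)
Fixpoint excess i x n : nat :=
  if n is m.+1 then (nones i x m + (excess i x m - nzeros i x m))%N else 0%N.

Fixpoint frow i x n : option nat :=
  if n is m.+1 then
    if (excess i x m < nzeros i x m)%N then Some m else frow i x m
  else None.

Fixpoint erow i x n : option nat :=
  if n is m.+1 then
    if (nzeros i x m < excess i x m)%N then erow i x m
    else if (0 < nones i x m)%N then Some m else None
  else None.

(** The first two clauses are monotonicity in the value and from row to row; the third singles out
    the tuples of B(Lambda). *)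
Definition valid (x : state) : Prop :=
  [/\ forall j, x false j <= x true j <= x false j + k%:Z,
      forall b j, x b j.+1 <= x b j
    & forall j, x false j.+1 = x false j \/ x true j.+1 = x true j].

Lemma frowP i x n j : frow i x n = Some j ->
  [/\ (j < n)%N, (excess i x j < nzeros i x j)%N &
      forall m, (j < m < n)%N -> (nzeros i x m <= excess i x m)%N].
Proof.
elim: n => [//|n IH] /=; case: ltnP => [lt [<-]|le /IH [jn lt H]].
  by split => // m; lia.
split => // [|m /andP[jm mn]]; first by lia.
by move: mn; rewrite ltnS leq_eqVlt => /orP[/eqP-> //|mn]; apply: H; lia.
Qed.

Lemma frow_intro i x n j : (j < n)%N -> (excess i x j < nzeros i x j)%N ->
  (forall m, (j < m < n)%N -> (nzeros i x m <= excess i x m)%N) ->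
  frow i x n = Some j.
Proof.
elim: n => [//|n IH] jn lt H /=.
have [-> | jNn] := eqVneq n j; first by rewrite lt.
rewrite ltnNge H /=; last by lia.
by apply: IH => // [|m ?]; [lia | apply: H; lia].
Qed.

Lemma erowP i x n j : erow i x n = Some j ->
  [/\ (j < n)%N, (excess i x j <= nzeros i x j)%N, (0 < nones i x j)%N &
      forall m, (j < m < n)%N -> (nzeros i x m < excess i x m)%N].
Proof.
elim: n => [//|n IH] /=; case: ltnP => [lt /IH [jn le p H]|le].
  split => // [|m /andP[jm mn]]; first by lia.
  by move: mn; rewrite ltnS leq_eqVlt => /orP[/eqP-> //|mn]; apply: H; lia.
by case: ifP => // p [<-]; split => // m; lia.
Qed.

Lemma erow_excess i x n : erow i x n = None -> excess i x n = 0%N.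
Proof.
elim: n => [//|n IH] /=; case: ltnP => [lt /IH E|le]; first by lia.
by case: ifP => // /negbT; lia.
Qed.

Lemma shift_entry_same d c j x : shift_entry d c j x c j = x c j + d.
Proof. by rewrite /shift_entry !eqxx. Qed.

Lemma shift_entry_vcol d i j x n :
  shift_entry d (vcol i j) j x (vcol i n) n = if n == j then x (vcol i n) n + d else x (vcol i n) n.
Proof. by rewrite /shift_entry andbC; case: (eqVneq n j) => [->|_]; rewrite ?eqxx. Qed.

Lemma shift_entry_nvcol d i j x n : shift_entry d (vcol i j) j x (~~ vcol i n) n = x (~~ vcol i n) n.
Proof. rewrite /shift_entry andbC; case: (eqVneq n j) => /= [->|//]; by case: vcol. Qed.

Lemma shift_entry_vcolS d i j x n : shift_entry d (vcol i j) j x (vcol i n) n.+1 = x (vcol i n) n.+1.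
Proof. by move: (shift_entry_nvcol d i j x n.+1); rewrite vcolS negbK. Qed.

(* Color-i moves change every second entry of the state only, so the bounds of
   the moving entries stay put. *)
Lemma prv_shift d i j x n : prv (shift_entry d (vcol i j) j x) (vcol i n) n = prv x (vcol i n) n.
Proof. by move: (shift_entry_nvcol d i j x n); rewrite /prv; case: (vcol i n) => /= ->. Qed.

Lemma lo_shift d i j x n : lo (shift_entry d (vcol i j) j x) (vcol i n) n = lo x (vcol i n) n.
Proof. by rewrite /lo prv_shift shift_entry_vcolS. Qed.

Lemma hi_shift d i j x n : hi (shift_entry d (vcol i j) j x) (vcol i n) n = hi x (vcol i n) n.
Proof.
case: n => [|n]; rewrite /hi /nxt prv_shift // vcolS.
by rewrite shift_entry_nvcol.
Qed.

Lemma validE i x : valid x <-> forall n,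
  [/\ prv x (vcol i n) n <= x (vcol i n) n <= nxt x (vcol i n) n,
      x (vcol i n) n.+1 <= x (vcol i n) n,
      x (~~ vcol i n) n.+1 <= x (~~ vcol i n) n
    & x (vcol i n) n.+1 = x (vcol i n) n \/ x (~~ vcol i n) n.+1 = x (~~ vcol i n) n].
Proof.
split=> [[V1 V2 V3] n | H].
- split; rewrite ?V2 //.
  + by have := V1 n; rewrite /nxt /prv; case: vcol; lia.
  + by case: (vcol i n) (V3 n) => /= -[]; auto.
- split=> [n | b n | n]; have [H1 H2 H3 H4] := H n.
  + by move: H1; rewrite /nxt /prv; case: vcol; lia.
  + by case: b H2 H3; case: vcol.
  + by move: H4; case: vcol => /= -[]; auto.
Qed.

Lemma lo_le i x n : valid x -> lo x (vcol i n) n <= x (vcol i n) n.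
Proof. by move=> /(validE i) H; have [] := H n; rewrite /lo; lia. Qed.

Lemma le_hi i x n : valid x -> x (vcol i n) n <= hi x (vcol i n) n.
Proof.
move=> /(validE i) H; have [] := H n; rewrite /hi; case: n => [|n]; first lia.
by have [_ _] := H n; rewrite vcolS; lia.
Qed.

Lemma valid_fshift i x n j : valid x -> frow i x n = Some j -> (j.+1 < n)%N ->
  valid (shift_entry 1 (vcol i j) j x).
Proof.
move=> Vx /frowP [_ fj Hj] jn; have := Hj j.+1; rewrite ltnSn jn => /(_ isT) fj1.
apply/(validE i) => m; have [H1 H2 H3 H4] := (validE i x).1 Vx m.
rewrite /nxt prv_shift shift_entry_vcolS shift_entry_nvcol shift_entry_vcol.
rewrite -vcolS shift_entry_vcol vcolS.
rewrite -[prv _ _ _ + _]/(nxt _ _ _).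
have hj := le_hi i j Vx; move: fj; rewrite /nzeros => fj.
have [Em|Nm] := eqVneq m j.
  subst m; rewrite (gtn_eqF (ltnSn j)).
  have : hi x (vcol i j) j <= nxt x (vcol i j) j by rewrite /hi; case: (j); lia.
  split; try lia.
  (* If the rows agree in the entry being raised, row [j] has no 1s, and the 0s of row [j] absorb
     those from rows of smaller index. All 0s of row [j + 1] cancel, so it has none: its own moving
     entry is at its upper end, which is the entry of row [j]. *)
  case: H4 => [E|]; [|by right].
  right; move: fj1 H1 hj fj; rewrite /= /nones /nzeros vcolS /hi /nxt /lo /prv.
  have [] := (validE i x).1 Vx j.+1; rewrite vcolS /nxt /prv.
  case: (vcol i j) E H2 H3 => /=; lia.
have [Em|Nm'] := eqVneq m.+1 j.
  subst j; split; try lia.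
    by move: fj hj; rewrite /hi vcolS; lia.
  case: H4 => [|E]; first by left.
  by move: fj hj; rewrite /hi vcolS; lia.
split=> //; lia.
Qed.

(** Dual to [valid_fshift], with rows [j - 1] and [j] as the critical pair: if they agree in the
    entry being lowered, row [j] has no 0s, so row [j - 1] can have no 1s and its moving entry
    equals that of row [j]. *)
Lemma valid_eshift i x n j : valid x -> erow i x n = Some j ->
  valid (shift_entry (-1) (vcol i j) j x).
Proof.
move=> Vx /erowP [_ ej oj _].
apply/(validE i) => m; have [H1 H2 H3 H4] := (validE i x).1 Vx m.
rewrite /nxt prv_shift shift_entry_vcolS shift_entry_nvcol shift_entry_vcol.
rewrite -vcolS shift_entry_vcol vcolS.
rewrite -[prv _ _ _ + _]/(nxt _ _ _).
have lj := lo_le i j Vx; have hj := le_hi i j Vx; move: oj ej; rewrite /nones => oj.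
have [Em|Nm] := eqVneq m j.
  subst m; rewrite (gtn_eqF (ltnSn j)) => _.
  by split; move: oj lj; rewrite /lo; lia.
have [Em|Nm'] := eqVneq m.+1 j.
  subst j => /= ej; split; try lia.
  case: H4 => [|E]; first by left.
  left; move: ej oj hj E lj H1 H2 H3; rewrite /nones /nzeros /lo /hi /nxt /prv !vcolS.
  have [] := (validE i x).1 Vx m.+1; rewrite vcolS /nxt /prv.
  case: (vcol i m) => /=; lia.
split=> //; lia.
Qed.

Lemma nones_shift i d j x n : n != j -> nones i (shift_entry d (vcol i j) j x) n = nones i x n.
Proof. by move=> nj; rewrite /nones lo_shift shift_entry_vcol (negbTE nj). Qed.

Lemma nzeros_shift i d j x n : n != j -> nzeros i (shift_entry d (vcol i j) j x) n = nzeros i x n.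
Proof. by move=> nj; rewrite /nzeros hi_shift shift_entry_vcol (negbTE nj). Qed.

Lemma excess_shift_le i d j x n : (n <= j)%N ->
  excess i (shift_entry d (vcol i j) j x) n = excess i x n.
Proof.
elim: n => [//|n IH] nj /=.
by rewrite nones_shift ?nzeros_shift ?IH //; lia.
Qed.

(** Past row [j], each row receives strictly more 1s than it has 0s, so its 0s still cancel when one
    1 is lost. Hence the raising move finds the same corner and undoes the lowering one. *)
Lemma erow_shift i x n j : valid x -> erow i x n = Some j ->
  let x' := shift_entry (-1) (vcol i j) j x in
  frow i x' n = Some j /\ (excess i x' n).+1 = excess i x n.
Proof.
move=> Vx /erowP [jn ej oj Hj] x'.
have lj := lo_le i j Vx; have hj := le_hi i j Vx.
have onesj : (nones i x' j).+1 = nones i x j.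
  by move: oj; rewrite /x' /nones lo_shift shift_entry_same; lia.
have zerosj : nzeros i x' j = (nzeros i x j).+1.
  by rewrite /x' /nzeros hi_shift shift_entry_same; lia.
have exsj : excess i x' j = excess i x j by apply: excess_shift_le.
have E m : (j < m <= n)%N -> (excess i x' m).+1 = excess i x m.
  elim: m => [//|m IH] /andP[jm mn] /=.
  have [Ej|Nj] := eqVneq m j; first by subst m; rewrite exsj zerosj; lia.
  have {}IH := IH ltac:(lia); have := Hj m ltac:(lia).
  rewrite /x' nones_shift // nzeros_shift // -/x'; lia.
split; last by apply: E; lia.
apply: frow_intro => // [|m jm]; first by rewrite exsj zerosj.
have := E m ltac:(lia); have := Hj m jm.
rewrite /x' nzeros_shift //; last by lia.
rewrite -/x'; lia.
Qed.

(* The Demazure set of the reduced word of length [L] with leftmost letter [i]. *)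
Definition dstate (i : bool) (L : nat) (x : state) : Prop :=
  [/\ valid x,
      forall n, (L <= n)%N -> x (vcol i n) n = gnd (vcol i n)
    & forall n, (L <= n.+1)%N -> x (~~ vcol i n) n = gnd (~~ vcol i n)].

Lemma dstate_gnd i L x n b : dstate i L x -> (L <= n)%N -> x b n = gnd b.
Proof.
move=> [_ H1 H2] Ln; have := H1 n Ln; have := H2 n (leqW Ln).
by case: vcol b => -[].
Qed.

Lemma dstateS i L x : dstate (~~ i) L x -> dstate i L.+1 x.
Proof.
move=> D; have [V H1 H2] := D.
split=> // [n Ln|n]; first by apply: dstate_gnd D _; lia.
by rewrite ltnS -vcolN => /H1.
Qed.

Lemma dstate0 i x : dstate i 0 x <-> forall b n, x b n = gnd b.
Proof.
split=> [D b n|H]; first exact: dstate_gnd D _.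
split=> [|n _|n _]; rewrite ?H //.
by split=> [j|b j|j]; rewrite !H ?/gnd; try lia; left.
Qed.

(** For [j >= L] the moving entry of row [j] is bounded by the same entry of row [j - 1], which is
    already trivial; no 0 is left there. *)
Lemma dstate_frow i L x n j : (0 < L)%N -> dstate i L x ->
  frow i x n = Some j -> (j < L)%N.
Proof.
move=> L0 D /frowP [_ fj _]; have V : valid x by case: D.
rewrite ltnNge; apply/negP => Lj.
have := le_hi i j V; move: fj; rewrite /nzeros /hi.
case: j Lj => [|j] Lj; first lia.
have [_ _ /(_ j ltac:(lia))] := D.
by rewrite (dstate_gnd (n := j.+1) _ D) // vcolS; lia.
Qed.

Lemma dstate_fshift i L x n j : (0 < L < n)%N -> dstate i L x ->
  frow i x n = Some j -> dstate i L (shift_entry 1 (vcol i j) j x).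
Proof.
move=> /andP[L0 Ln] D fj; have jL := dstate_frow L0 D fj.
have [V H1 H2] := D; split=> [|m Lm|m Lm].
- by apply: valid_fshift V fj _; lia.
- by rewrite shift_entry_vcol H1 //; case: eqP => //; lia.
- by rewrite shift_entry_nvcol H2.
Qed.

Lemma dstate_erow i L x n j : (0 < L)%N -> dstate i L x ->
  erow i x n = Some j -> (j < L)%N.
Proof.
move=> L0 D /erowP [_ _ ej _]; have V : valid x by case: D.
rewrite ltnNge; apply/negP => Lj.
have := lo_le i j V; move: ej; rewrite /nones /lo.
have [_ H1 H2] := D; rewrite H1 // (dstate_gnd (n := j.+1) _ D); last lia.
lia.
Qed.

Lemma dstate_eshift i L x n j : (0 < L)%N -> dstate i L x ->
  erow i x n = Some j -> dstate i L (shift_entry (-1) (vcol i j) j x).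
Proof.
move=> L0 D ej; have jL := dstate_erow L0 D ej.
have [V H1 H2] := D; split=> [|m Lm|m Lm].
- exact: valid_eshift V ej.
- by rewrite shift_entry_vcol H1 //; case: eqP => //; lia.
- by rewrite shift_entry_nvcol H2.
Qed.

Lemma excess_le i x m n : excess i x n = 0%N -> (m <= n)%N ->
  (forall j, (m <= j < n)%N -> nzeros i x j = 0%N) -> excess i x m = 0%N.
Proof.
elim: n => [|n IH] /=; first by rewrite leqn0 => _ /eqP->.
move=> E; rewrite leq_eqVlt => /orP[/eqP->//|mn] H.
have := H n ltac:(lia) => z.
by apply: IH => [||j jm]; [lia | lia | apply: H; lia].
Qed.

(** The elements killed by [etilde i] come from the shorter word: the rows past [L] have no 0s, so
    no 1 survives below them, and row [L] becomes trivial. *)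
Lemma dstate_top i L x n : (L < n)%N -> dstate i L.+1 x -> excess i x n = 0%N ->
  dstate (~~ i) L x.
Proof.
move=> Ln D; have [V H1 H2] := D => en.
have V' := (validE i x).1 V.
have eL1 : excess i x L.+1 = 0%N.
  apply: excess_le en _ _ => // [[//|j]] /andP[Lj _].
  have := le_hi i j.+1 V; rewrite /nzeros /hi H1 // vcolS H2 //; lia.
have gL : x (vcol i L) L = gnd (vcol i L).
  have := lo_le i L V; move: eL1; rewrite /= /nones /lo.
  rewrite (dstate_gnd (n := L.+1) _ D) // /prv.
  have := H2 L (leqnn _); rewrite /gnd; case: vcol => /= ->; lia.
split=> // [m Lm|m Lm].
  by rewrite vcolN H2.
rewrite vcolN negbK; move: Lm; rewrite leq_eqVlt => /orP[/eqP EL|Lm]; last first.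
  by move: Lm; rewrite ltnS leq_eqVlt => /orP[/eqP <- //|]; apply: H1.
(* What remains is row [m = L - 1]. If it agrees with row [L] in the moving entry of row [L], then
   row [L] has no 0s to cancel 1s of row [m], so row [m] has none. *)
subst L; have [P1 P2 P3 P4] := V' m.
have lm := lo_le i m V; have := lo_le i m.+1 V; have := le_hi i m.+1 V.
move: gL (H2 m.+1 (leqnn _)) P1 P2 P3 P4 eL1 lm; rewrite /= /nones /nzeros /lo /hi /nxt /prv !vcolS.
by rewrite /gnd; case: (vcol i m) => /=; lia.
Qed.

End States.

(** * Cancellation in signatures *)

Section Reduction.
Variable Lam : domweight.
Implicit Types w : seq (tcorner Lam).

(** Reduction from right to left, keeping a normal form of the tail. It is invariant under
    [cancel1], hence equals the iterated deletion. *)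
Definition red_cons (a : tcorner Lam) w : seq (tcorner Lam) :=
  if w is b :: w' then if ~~ tc_convex a && tc_convex b then w' else a :: w
  else [:: a].

Definition red w : seq (tcorner Lam) := foldr red_cons [::] w.

Lemma cancel1_cons a b w : cancel1 [:: a, b & w] =
  if ~~ tc_convex a && tc_convex b then w else a :: cancel1 (b :: w).
Proof. by []. Qed.

Lemma redE a w : red (a :: w) = red_cons a (red w).
Proof. by []. Qed.

Lemma red_cancel1 w : red (cancel1 w) = red w.
Proof.
elim: w => [//|a [//|b w] IH].
rewrite cancel1_cons; case: ifP => [/andP[a0 b1]|ab].
  rewrite !redE; by case: (red w) => [|c w'] /=; rewrite ?b1 /= ?a0 ?b1.
by rewrite 2!redE IH.
Qed.

(** A pass that deletes nothing means a reduced word, and any other pass shortens it, so [size w]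
    passes suffice. *)
Lemma cancel1_fix w :
  cancel1 w = w /\ red w = w \/ (size (cancel1 w) < size w)%N.
Proof.
elim: w => [|a [|b w] IH]; [by left|by left|].
rewrite cancel1_cons; case: ifP => [_|ab]; first by right => /=; lia.
case: IH => [[E1 E2]|lt]; [left|by right].
by rewrite E1 redE E2 /= ab.
Qed.

Lemma iter_cancel1 n w : (size w <= n)%N -> iter n (@cancel1 Lam) w = red w.
Proof.
elim: n w => [|n IH] w; first by rewrite leqn0 => /nilP ->.
move=> sz; rewrite iterSr; case: (cancel1_fix w) => [[E1 E2]|lt]; last first.
  by rewrite IH ?red_cancel1 //; lia.
rewrite E1 E2; elim: (n) => //= m ->; exact: E1.
Qed.

Lemma red_ones u w : all (@tc_convex _) u -> red (u ++ w) = u ++ red w.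
Proof.
elim: u => [//|a u IH] /= /andP[a1 /IH E].
rewrite E /red_cons a1 /=.
by case: (u ++ red w).
Qed.

(** The 0s next to [p] cancel first, so the leftmost 0s of [v] and the last 1s of [p] survive. *)
Lemma red_zeros v w p q : all (fun c => ~~ tc_convex c) v ->
  all (@tc_convex _) p -> all (fun c => ~~ tc_convex c) q -> red w = p ++ q ->
  red (v ++ w) = take (size v - size p) v ++ drop (size v) p ++ q.
Proof.
move=> Hv Hp Hq E; elim: v Hv => [|a v IH] /=; first by rewrite drop0.
move=> /andP[a0 Hv]; move: IH => /(_ Hv) IH; rewrite IH.
have [le|lt] := leqP (size p) (size v).
  rewrite subSn // !drop_oversize //=; last by rewrite leqW.
  case Ev: (take _ v) => [|c v'] /=.
    by case: q Hq {E IH} => [//|c q] /= /andP[/negbTE -> _]; rewrite andbF.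
  have /mem_take cv : c \in take (size v - size p) v by rewrite Ev inE eqxx.
  by rewrite (negbTE (allP Hv _ cv)) andbF.
rewrite (eqP (_ : (size v).+1 - size p == 0)%N) ?subn_eq0 //.
rewrite (eqP (_ : size v - size p == 0)%N) ?subn_eq0 ?take0 //; last exact: ltnW.
rewrite (drop_nth a lt) /= /red_cons a0 /=.
by rewrite (allP Hp) // mem_nth.
Qed.

End Reduction.

(** * The signature of a tuple *)

Section Signature.
Variables s t : nat.
Let k : nat := (s + t)%N.
Hypothesis k_gt0 : (0 < k)%N.
Let Lam : domweight := (s, t).

Lemma ordm_subproof (N : int) : (`|(N %% k%:Z)%Z| < level Lam)%N.
Proof.
have := modz_ge0 N (_ : k%:Z != 0); have := ltz_pmod N (_ : 0 < k%:Z).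
by rewrite /level /= -/k; lia.
Qed.

Definition ordm (N : int) : 'I_(level Lam) := Ordinal (ordm_subproof N).

Lemma ordmE (l : 'I_(level Lam)) (a : int) : ordm (l%:Z - k%:Z * a) = l.
Proof.
apply: val_inj; rewrite /= -mulrN mulrC addrC modzMDl modz_small //.
by have := ltn_ord l; rewrite [X in (_ < X)%N]/level /= -/k; lia.
Qed.

Lemma divzE (l : 'I_(level Lam)) (a : int) : ((l%:Z - k%:Z * a) %/ k%:Z)%Z = - a.
Proof.
rewrite -mulrN mulrC addrC divzMDl; last by lia.
rewrite divz_small ?addr0 //.
by have := ltn_ord l; rewrite [X in (_ < X)%N]/level /= -/k; lia.
Qed.

Lemma ordm_split (N : int) : N = (ordm N)%:Z - k%:Z * - (N %/ k%:Z)%Z.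
Proof.
have := modz_ge0 N (_ : k%:Z != 0) => /(_ ltac:(lia)) H.
by rewrite /= gez0_abs // {1}(divz_eq N k%:Z); ring.
Qed.

(* [N = l - k * a], with [l] a component, stands for that component shifted by
   [2 * a], so its value there is [2 * a + c] or [2 * a + c + 1]. *)
Definition corner_at (c : bool) (j : nat) (b : bool) (N : int) : tcorner Lam :=
  (ordm N, (if b then j.+1 else j, (c : nat)%:Z + (~~ b : nat)%:Z - 2 * (N %/ k%:Z)%Z, b)).

Lemma corner_atE c j b (l : 'I_(level Lam)) a :
  corner_at c j b (l%:Z - k%:Z * a) =
  (l, (if b then j.+1 else j, 2 * a + (c : nat)%:Z + (~~ b : nat)%:Z, b)).
Proof. by rewrite /corner_at ordmE divzE; congr (_, (_, _, _)); ring. Qed.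

Definition ones_row i x j : seq (tcorner Lam) :=
  [seq corner_at (vcol i j) j true (lo s t x (vcol i j) j + n%:Z)
     | n <- iota 0 (nones s t i x j)].

Definition zeros_row i x j : seq (tcorner Lam) :=
  [seq corner_at (vcol i j) j false (x (vcol i j) j + n%:Z)
     | n <- iota 0 (nzeros s t i x j)].

Fixpoint rows i x n : seq (tcorner Lam) :=
  if n is m.+1 then ones_row i x m ++ zeros_row i x m ++ rows i x m else [::].

Lemma all_ones_row i x j : all (@tc_convex _) (ones_row i x j).
Proof. by apply/allP => c /mapP [n _ ->]. Qed.

Lemma all_zeros_row i x j : all (fun c => ~~ tc_convex c) (zeros_row i x j).
Proof. by apply/allP => c /mapP [n _ ->]. Qed.

Lemma red_rows i x n : exists p q,
  [/\ red (rows i x n) = p ++ q, all (@tc_convex _) p,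
      all (fun c => ~~ tc_convex c) q, size p = excess s t i x n
    & ohead q = omap (fun j => corner_at (vcol i j) j false (x (vcol i j) j))
                     (frow s t i x n)].
Proof.
elim: n => [|n [p [q [E Hp Hq sp hq]]]] /=; first by exists [::], [::].
exists (ones_row i x n ++ drop (size (zeros_row i x n)) p),
  (take (size (zeros_row i x n) - size p) (zeros_row i x n) ++ q).
have sz : size (zeros_row i x n) = nzeros s t i x n by rewrite size_map size_iota.
have so : size (ones_row i x n) = nones s t i x n by rewrite size_map size_iota.
rewrite red_ones ?all_ones_row // (red_zeros (all_zeros_row i x n) Hp Hq E).
split.
- rewrite sz sp; have [le|lt] := leqP (excess s t i x n) (nzeros s t i x n).
    by rewrite drop_oversize ?sp // cats0.
  by rewrite (eqP (_ : nzeros s t i x n - excess s t i x n == 0)%N) ?take0 /= ?catA // subn_eq0 ltnW.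
- by rewrite all_cat all_ones_row; apply/allP => c /mem_drop /(allP Hp).
- rewrite all_cat Hq andbT; apply/allP => c /mem_take; exact: (allP (all_zeros_row i x n)).
- by rewrite size_cat size_drop so sz sp.
(* The surviving 0s of row [n] are its leftmost ones, so the first has offset 0 from the moving
   entry. *)
- rewrite sz sp; case: ltnP => [lt|le]; last first.
    by rewrite (eqP (_ : nzeros s t i x n - excess s t i x n == 0)%N) ?take0 // subn_eq0.
  rewrite /zeros_row; case: (nzeros s t i x n) lt => [//|m] lt.
  by rewrite subSn //= addr0.
Qed.

(* The order of the corners, at fixed color, is that of these integers. *)
Definition npos (c : tcorner Lam) : int :=
  (tc_comp c)%:Z - k%:Z * (tc_diag c %/ 2)%Z.

Lemma tc_geq_npos (c c' : tcorner Lam) : color (tc_diag c) = color (tc_diag c') ->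
  tc_geq c c' = (npos c <= npos c').
Proof.
rewrite /tc_geq /npos /color => H.
have := ltn_ord (tc_comp c); have := ltn_ord (tc_comp c').
rewrite /level /= -/k.
set d := tc_diag c in H *; set d' := tc_diag c' in H *.
move: (nat_of_ord (tc_comp c)) (nat_of_ord (tc_comp c')) => l l' lk lk'.
have [a Ea] : exists a, a = (d %/ 2)%Z by exists (d %/ 2)%Z.
have [a' Ea'] : exists a, a = (d' %/ 2)%Z by exists (d' %/ 2)%Z.
rewrite -Ea -Ea'.
have -> : (d' < d) = (a' < a) by lia.
have -> : (d == d') = (a == a') by lia.
case: (ltgtP a' a) => aa /=; last by rewrite aa; lia.
  by apply/esym; nia.
by apply/esym/negbTE; nia.
Qed.

(** The translation that puts the indices [N] of all rows on the common scale of [npos]. *)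
Definition off i j : int := k%:Z * ((j.+1%:Z + (vcol i j : nat)%:Z) %/ 2)%Z.

Lemma diag_corner_at c j b N :
  tc_diag (corner_at c j b N) = j.+1%:Z + (c : nat)%:Z - 2 * (N %/ k%:Z)%Z.
Proof. by rewrite /tc_diag /tc_row /tc_val /=; case: b => /=; lia. Qed.

Lemma color_corner_at i j b N : color (tc_diag (corner_at (vcol i j) j b N)) = i.
Proof. by rewrite diag_corner_at /color /vcol; lia. Qed.

Lemma npos_corner_at i j b N : npos (corner_at (vcol i j) j b N) = N - off i j.
Proof.
rewrite /npos diag_corner_at /off -[tc_comp _]/(ordm N).
have -> : ((j.+1%:Z + (vcol i j : nat)%:Z - 2 * (N %/ k%:Z)%Z) %/ 2)%Z =
  ((j.+1%:Z + (vcol i j : nat)%:Z) %/ 2)%Z - (N %/ k%:Z)%Z by lia.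
have := ordm_split N; move: (N %/ k%:Z)%Z (nat_of_ord (ordm N)) => d r ->; ring.
Qed.

(** Up to the translation, the fixed entry of row [j] bounds the moving entry of row [j + 1] from
    above and, as [prv], that of row [j] from below. *)
Lemma hi_lo i x j : valid s t x ->
  hi s t x (vcol i j.+1) j.+1 - off i j.+1 <= lo s t x (vcol i j) j - off i j.
Proof.
move=> /(validE s t i) /(_ j) [H1 H2 H3 _]; move: H1 H2 H3.
have : off i j.+1 = off i j + (if vcol i j then 0 else k%:Z).
  rewrite /off vcolS.
  have -> : ((j.+2%:Z + (~~ vcol i j : nat)%:Z) %/ 2)%Z =
    ((j.+1%:Z + (vcol i j : nat)%:Z) %/ 2)%Z + (~~ vcol i j : nat)%:Z by rewrite /vcol; lia.
  by case: vcol => /=; ring.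
move=> ->; rewrite /hi /lo /nxt /prv vcolS; case: (vcol i j) => /=; lia.
Qed.

Lemma mem_rows i x n c : valid s t x -> reflect (exists j N, (j < n)%N /\
   (lo s t x (vcol i j) j <= N < x (vcol i j) j /\ c = corner_at (vcol i j) j true N \/
    x (vcol i j) j <= N < hi s t x (vcol i j) j /\ c = corner_at (vcol i j) j false N))
  (c \in rows i x n).
Proof.
move=> V; apply: (iffP idP); elim: n => [//|n IH] /=.
- rewrite !mem_cat => /or3P [/mapP[m]|/mapP[m]|/IH].
  + rewrite mem_iota => /andP[_]; rewrite add0n /nones => lt ->; have := lo_le i n V.
    by exists n, (lo s t x (vcol i n) n + m%:Z); split => //; left; split=> //; lia.
  + rewrite mem_iota => /andP[_]; rewrite add0n /nzeros => lt ->; have := le_hi i n V.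
    by exists n, (x (vcol i n) n + m%:Z); split => //; right; split=> //; lia.
  + by move=> [j [N [jn H]]]; exists j, N; split=> //; lia.
- by move=> [j [N []]].
- move=> [j [N [jn H]]]; rewrite !mem_cat.
  move: jn; rewrite ltnS leq_eqVlt => /orP[/eqP Ej|jn]; last first.
    by rewrite IH ?orbT //; exists j, N.
  subst j; case: H => [[H ->]|[H ->]].
    apply/or3P/Or31/mapP; exists `|N - lo s t x (vcol i n) n|%N.
      by rewrite mem_iota /nones; lia.
    by congr corner_at; lia.
  apply/or3P/Or32/mapP; exists `|N - x (vcol i n) n|%N.
    by rewrite mem_iota /nzeros; lia.
  by congr corner_at; lia.
Qed.

(** Strictness is the point: it makes the sorted listing of these corners unique, which identifies
    [rows] with the signature. *)
Lemma pairwise_rows i x n : valid s t x ->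
  pairwise (fun a b => npos a < npos b) (rows i x n).
Proof.
move=> V; elim: n => [//|n IH] /=.
have Hlt m : pairwise ltn (iota 0 m).
  by rewrite -(sorted_pairwise ltn_trans) iota_ltn_sorted.
have lon := lo_le i n V.
rewrite !pairwise_cat IH !pairwise_map allrel_catr.
have -> : pairwise (relpre (fun m : nat => corner_at (vcol i n) n true (lo s t x (vcol i n) n + m%:Z))
    (fun a b => npos a < npos b)) (iota 0 (nones s t i x n)).
  by apply: sub_pairwise (Hlt _) => a b /=; rewrite !npos_corner_at; lia.
have -> : pairwise (relpre (fun m : nat => corner_at (vcol i n) n false (x (vcol i n) n + m%:Z))
    (fun a b => npos a < npos b)) (iota 0 (nzeros s t i x n)).
  by apply: sub_pairwise (Hlt _) => a b /=; rewrite !npos_corner_at; lia.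
have mono j : (j < n)%N -> hi s t x (vcol i n) n - off i n <= lo s t x (vcol i j) j - off i j.
  elim: (n) => [//|m IHm]; rewrite ltnS leq_eqVlt => /orP[/eqP->|jm]; first exact: hi_lo.
  apply: le_trans (hi_lo i m V) (le_trans _ (IHm jm)).
  by have := lo_le i m V; have := le_hi i m V; lia.
have low c : c \in rows i x n -> hi s t x (vcol i n) n - off i n <= npos c.
  move=> /(mem_rows _ _ _ V) [j [N [jn H]]]; apply: (le_trans (mono j jn)).
  have := lo_le i j V.
  by case: H => -[H ->]; rewrite npos_corner_at; lia.
have hin := le_hi i n V.
rewrite !andbT -andbA /=; apply/and3P; split; apply/allrelP.
- move=> c c' /mapP [m + ->] /mapP[m' + ->]; rewrite !mem_iota !npos_corner_at /nones; lia.
- by move=> c c' /mapP [m + ->] /low; rewrite mem_iota npos_corner_at /nones; lia.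
- by move=> c c' /mapP [m + ->] /low; rewrite mem_iota npos_corner_at /nzeros; lia.
Qed.

End Signature.

(** * Tuples realizing a state, and their signatures *)

Lemma tc_geq_total (Lam : domweight) : total (@tc_geq Lam).
Proof. by move=> a b; rewrite /tc_geq; lia. Qed.

Lemma tc_geq_trans (Lam : domweight) : transitive (@tc_geq Lam).
Proof. by move=> a b c; rewrite /tc_geq; lia. Qed.

Lemma int_parity (e : int) : exists a (c : bool), e = 2 * a + (c : nat)%:Z.
Proof. by exists (e %/ 2)%Z, (odd `|e|%N); lia. Qed.

Lemma uniq_corners g y : uniq (corners g y).
Proof.
rewrite /corners cat_uniq !map_inj_uniq ?filter_uniq ?iota_uniq ?andbT ?andTb.
- by apply/hasPn => c /mapP [m _ ->]; apply/mapP => -[m' _].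
all: by move=> // m m' [].
Qed.

Lemma concave_size g y m :
  (m == 0%N) || (entry g y m.-1 < entry g y m) -> (m <= size y)%N.
Proof.
move=> H; rewrite leqNgt; apply/negP => lt.
by move: H; rewrite /entry !nth_default ?ltxx; lia.
Qed.

Lemma mem_concave g y m n : ((m, n, false) \in corners g y) =
  (n == entry g y m) && ((m == 0%N) || (entry g y m.-1 < entry g y m)).
Proof.
rewrite mem_cat; apply/idP/idP => [/orP[/mapP[m']|/mapP[m']//]|].
  by rewrite mem_filter => /andP[H _] [-> ->]; rewrite eqxx.
move=> /andP[/eqP -> H]; apply/orP; left; apply/mapP; exists m => //.
by rewrite mem_filter H mem_iota /= add0n ltnS (concave_size H).
Qed.

Lemma mem_convex g y m n : ((m, n, true) \in corners g y) =
  [&& (0 < m)%N, n == entry g y m.-1 & entry g y m.-1 < entry g y m].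
Proof.
rewrite mem_cat; apply/idP/idP => [/orP[/mapP[m']//|/mapP[m']]|].
  by rewrite mem_filter mem_iota => /and3P[H m0 _] [-> ->]; rewrite eqxx H m0.
move=> /and3P[m0 /eqP -> H]; apply/orP; right; apply/mapP; exists m => //.
rewrite mem_filter H mem_iota m0 /= add1n ltnS leqNgt; apply/negP => lt.
by move: H; rewrite /entry !nth_default ?ltxx; lia.
Qed.

Section Realization.
Variables s t : nat.
Let k : nat := (s + t)%N.
Hypothesis k_gt0 : (0 < k)%N.
Let Lam : domweight := (s, t).

(* The second condition is y^l_j <= v <-> l < u_j(v) for v = [2 * a + c]. *)
Definition realizes J (x : state) (Y : eydtuple Lam) : Prop :=
  [/\ forall l, all (fun e => e < charge l) (Y l),
      forall (l : 'I_(level Lam)) j a (c : bool),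
        (entry (charge l) (Y l) j <= 2 * a + (c : nat)%:Z) = (l%:Z - k%:Z * a < x c j)
    & forall i, (ncolor i Y)%:Z = \sum_(j < J) (x (vcol i j) j - gnd s t (vcol i j))].

Section OneState.
Variables (J : nat) (x : state) (Y : eydtuple Lam).
Hypotheses (V : valid s t x) (RY : realizes J x Y).

(** y < v means y <= v - 1, and v - 1 has the other parity, with [a] lowered by one when v is even;
    this is the source of [prv]. *)
Lemma entry_lt (l : 'I_(level Lam)) j a (c : bool) :
  (entry (charge l) (Y l) j < 2 * a + (c : nat)%:Z) = (l%:Z - k%:Z * a < prv s t x c j).
Proof.
have [_ H _] := RY; rewrite /prv; case: c => /=.
  by rewrite addrC ltz1D; have := H l j a false; rewrite addr0.
rewrite addr0; have := H l j (a - 1) true; rewrite /= mulrBr.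
have -> : (2 * a - 2 * 1 + 1 : int) = 2 * a - 1 by ring.
by rewrite -ltzD1 subrK => ->; rewrite -/k; lia.
Qed.

Lemma entry_leS (l : 'I_(level Lam)) j a (c : bool) :
  (entry (charge l) (Y l) j <= 2 * a + (c : nat)%:Z + 1) = (l%:Z - k%:Z * a < nxt s t x c j).
Proof.
have [_ H _] := RY; rewrite /nxt /prv; case: c => /=.
  have <- : 2 * (a + 1) + (false : nat)%:Z = 2 * a + 1%N%:Z + 1 :> int by rewrite /=; lia.
  by rewrite H mulrDr -/k; lia.
by have := H l j a true; rewrite /= addr0 => ->; rewrite -/k; lia.
Qed.

(** For v = 2a + c, a convex corner means y_j = v < y_(j+1), and a concave one y_j = v + 1 with
    y_(j-1) <= v; through [realizes] these are the bounds by [lo], the entry and [hi]. *)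
Lemma corner_rows i (c : tcorner Lam) :
  (c.2 \in corners (charge c.1) (Y c.1)) && (color (tc_diag c) == i) ->
  exists j N,
   (lo s t x (vcol i j) j <= N < x (vcol i j) j /\ c = corner_at k_gt0 (vcol i j) j true N \/
    x (vcol i j) j <= N < hi s t x (vcol i j) j /\ c = corner_at k_gt0 (vcol i j) j false N).
Proof.
case: c => l [[m n] b]; rewrite /tc_diag /tc_row /tc_val /= => /andP[+ /eqP Hi].
have [_ H _] := RY.
case: b => [|]; [rewrite mem_convex|rewrite mem_concave].
  case: m Hi => [//|j] /= Hi /andP[/eqP En lt].
  have [a [c Ec]] := int_parity n.
  have Ecol : c = vcol i j by move: Hi; rewrite Ec /color /vcol; lia.
  exists j, (l%:Z - k%:Z * a); left; rewrite corner_atE addr0 -Ecol -Ec; split => //.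
  have := H l j a c; have := entry_lt l j a c; have := H l j.+1 a c.
  by rewrite /lo -Ec -En lexx ltxx En leNgt lt; lia.
move=> /andP[/eqP En Hm].
(* Adding the node lowers n to n - 1 and so raises u(n - 1): the parity that counts is that of n -
   1. *)
have [a [c Ec]] := int_parity (n - 1).
have Ecol : c = vcol i m.
  by move: Hi; rewrite (_ : n = 2 * a + (c : nat)%:Z + 1) /color /vcol; lia.
have Ec' : 2 * a + (c : nat)%:Z + 1 = n by lia.
exists m, (l%:Z - k%:Z * a); right; rewrite corner_atE -Ecol Ec'; split => //.
have := H l m a c; have := entry_leS l m a c.
rewrite /hi Ec' -Ec -En lexx => H1; rewrite -En in Hm.
case: m Hm {En Ecol Hi} H1 => [|j] /= Hm H1; first by lia.
have := H l j a c; rewrite -Ec; lia.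
Qed.

Lemma rows_corner i j N :
  (lo s t x (vcol i j) j <= N < x (vcol i j) j ->
   let c := corner_at k_gt0 (vcol i j) j true N in c.2 \in corners (charge c.1) (Y c.1)) /\
  (x (vcol i j) j <= N < hi s t x (vcol i j) j ->
   let c := corner_at k_gt0 (vcol i j) j false N in c.2 \in corners (charge c.1) (Y c.1)).
Proof.
have [_ H _] := RY.
rewrite (ordm_split k_gt0 N); move: (ordm k_gt0 N) (- (N %/ _)%Z) => l a.
rewrite !corner_atE -/k; move: (vcol i j) => c; split => Hc;
  rewrite [let _ := _ in _]/= ?mem_concave ?mem_convex ?succnK.
  have := H l j a c; have := entry_lt l j a c; have := H l j.+1 a c.
  move: (l%:Z - k%:Z * a) (entry _ _ j) (entry _ _ j.+1) Hc => n e e1.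
  by rewrite /lo; lia.
have := H l j a c; have := entry_leS l j a c.
case: j Hc => [|j] Hc; [|have := H l j a c]; rewrite ?succnK; move: Hc; rewrite /hi;
  [move: (entry _ _ 0)|move: (entry _ _ j) (entry _ _ j.+1) => e1];
  by move: (l%:Z - k%:Z * a) => n e; lia.
Qed.

Lemma signature_rows i : (forall b n, (J <= n)%N -> x b n = gnd s t b) ->
  signature i Y = rows k_gt0 i x J.+1.
Proof.
move=> gx.
set l0 := [seq c <- [seq (j, c) | j <- enum 'I_(level Lam), c <- corners (charge j) (Y j)]
       | color (tc_diag c) == i].
have pw := pairwise_rows k_gt0 i J.+1 V.
have rowcol c : c \in rows k_gt0 i x J.+1 -> color (tc_diag c) = i.
  by move=> /(mem_rows _ _ _ _ V) [j [N [_ [[_ ->]|[_ ->]]]]]; rewrite color_corner_at.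
have trans : transitive (fun a b : tcorner Lam => npos a < npos b).
  by move=> a b c; apply: lt_trans.
have rowsP c : c \in signature i Y <-> c \in rows k_gt0 i x J.+1.
  rewrite mem_sort mem_filter; split.
    move=> /andP[/eqP ci /flatten_mapP [l _ /mapP [c' lc E]]]; subst c.
    have [|j [N H]] := @corner_rows i (l, c'); first by rewrite lc ci eqxx.
    apply/(mem_rows _ _ _ _ V); exists j, N; split=> //.
    (* Row [J] is trivial but can carry 0s, hence the bound [J.+1]; past it the trivial neighbouring
       rows leave no room to move. *)
    rewrite ltnS leqNgt; apply/negP => Jj.
    have g1 := gx (vcol i j) j (ltnW Jj).
    case: H => -[+ _].
      by rewrite /lo g1 gx //; lia.
    case: (j) Jj g1 => [//|j'] Jj ->.
    by rewrite /hi gx //; lia.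
  move=> cr; rewrite (rowcol c cr) eqxx andTb; apply/flatten_mapP.
  have /(mem_rows _ _ _ _ V) [j [N [_ [[H E]|[H E]]]]] := cr;
    (exists c.1; first by rewrite mem_enum inE); apply/mapP; exists c.2;
    rewrite ?E //.
  - exact: (rows_corner i j N).1 H.
  - exact: (rows_corner i j N).2 H.
apply/esym/(@sorted_eq_in _ (@tc_geq Lam)).
- by move=> a b c _ _ _; apply: tc_geq_trans.
(* [tc_geq] ignores the row and the kind of a corner, so antisymmetry holds only on [rows], where
   [npos] separates the corners. *)
- move=> a b ar br /andP[]; rewrite !tc_geq_npos ?(rowcol _ ar) ?(rowcol _ br) // => ab ba.
  have [/nthP-/(_ a) [m ms Em] /nthP-/(_ a) [m' ms' Em']] := conj ar br.
  have /(pairwiseP a) P := pw.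
  case: (ltngtP m m') => [mm|mm|Emm]; last by rewrite -Em -Em' Emm.
    by have := P m m' ms ms' mm; rewrite Em Em'; lia.
  by have := P m' m ms' ms mm; rewrite Em Em'; lia.
- apply: pairwise_sorted; set r := rows _ _ _ _ in pw rowcol *.
  apply: (sub_in_pairwise (P := [in r])) pw; last exact/allP.
  move=> a b ar br /ltW.
  by rewrite -tc_geq_npos ?(rowcol _ ar) ?(rowcol _ br).
- exact/sort_sorted/tc_geq_total.
- apply: uniq_perm; last by move=> c; apply/idP/idP => /rowsP.
    by apply: pairwise_uniq pw => a; apply: ltxx.
  rewrite sort_uniq filter_uniq // allpairs_uniq_dep ?enum_uniq //.
    by move=> l _; apply: uniq_corners.
  by move=> [l c] [l' c'] _ _ [-> ->].
Qed.

End OneState.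
End Realization.

(** * Adding a node to a tuple *)

Lemma count_nodes (P : pred (nat * int)) g y M : (size y <= M)%N ->
  count P (nodes g y) =
  (\sum_(m < M) count P [seq (m : nat, (g - l%:Z)%R) | l <- iota 0 `|(g - entry g y m)%R|%N])%N.
Proof.
move=> sM; rewrite /nodes count_flatten -map_comp sumnE big_map.
rewrite -[X in iota 0 X]subn0 -/(index_iota 0 (size y)) big_mkord.
rewrite [LHS](big_ord_widen M
  (fun m => count P [seq (m, (g - l%:Z)%R) | l <- iota 0 `|(g - entry g y m)%R|%N])) //.
rewrite [LHS]big_mkcond /=; apply: eq_bigr => m _; case: ltnP => // le.
by rewrite /entry nth_default ?subrr.
Qed.

Section Entry.
Variables (g : int) (y : eyd) (m : nat).
Hypotheses (ylt : all (fun e => e < g) y) (msz : (m <= size y)%N).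
Let e : int := entry g y m.

Lemma entry_le : e <= g.
Proof.
rewrite /e /entry; have [lt|le] := ltnP m (size y); last by rewrite nth_default.
exact/ltW/(allP ylt)/mem_nth.
Qed.

(** As [m <= size y], [set_nth] inserts no padding [g], and [e - 1 < g]; the filter in [set_entry]
    therefore removes nothing. *)
Lemma set_entryE : set_entry g y m (e - 1) = set_nth g y m (e - 1) /\
  all (fun e => e < g) (set_entry g y m (e - 1)).
Proof.
have H : all (fun e => e < g) (set_nth g y m (e - 1)).
  apply/(all_nthP g) => i; rewrite size_set_nth nth_set_nth /= => im.
  have [_|im'] := eqVneq i m; first by have := entry_le; lia.
  apply/(allP ylt)/mem_nth; move: im; rewrite leq_max => /orP[im|//].
  by apply: leq_trans msz; rewrite ltn_neqAle im' -ltnS.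
by rewrite /set_entry; move/all_filterP: (H) => ->.
Qed.

Lemma entry_set_entry n :
  entry g (set_entry g y m (e - 1)) n = if n == m then e - 1 else entry g y n.
Proof. by rewrite set_entryE.1 /entry nth_set_nth. Qed.

Lemma count_set_entry (P : pred (nat * int)) :
  count P (nodes g (set_entry g y m (e - 1))) = (count P (nodes g y) + P (m, e))%N.
Proof.
have sz : (size (set_entry g y m (e - 1)) <= (size y).+1)%N.
  by rewrite set_entryE.1 size_set_nth; lia.
rewrite (count_nodes P g sz) (count_nodes P g (leqnSn _)).
have mS : (m < (size y).+1)%N by [].
rewrite (bigD1 (Ordinal mS)) //= [in RHS](bigD1 (Ordinal mS)) //= addnAC; congr addn.
  rewrite entry_set_entry eqxx -/e; have := entry_le.
  move=> le; have -> : `|(g - (e - 1))%R|%N = `|(g - e)%R|%N.+1 by lia.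
  rewrite -addn1 iotaD map_cat count_cat /= add0n addn0; congr (_ + _)%N.
  by congr (nat_of_bool (P (_, _))); lia.
apply: eq_bigr => n nm; rewrite entry_set_entry ifF //.
by apply/negbTE; rewrite -val_eqE in nm.
Qed.

End Entry.

Section Step.
Variables s t : nat.
Let k : nat := (s + t)%N.
Hypothesis k_gt0 : (0 < k)%N.
Let Lam : domweight := (s, t).
Variables (J : nat) (x : state) (Y : eydtuple Lam).
Hypotheses (V : valid s t x) (RY : realizes J x Y).
Hypothesis gx : forall b n, (J <= n)%N -> x b n = gnd s t b.

Lemma relevant_rows i : exists p q,
  [/\ [seq c <- relevant i Y | tc_convex c] = p,
      [seq c <- relevant i Y | ~~ tc_convex c] = q,
      size p = excess s t i x J.+1
    & ohead q = omap (fun j => corner_at k_gt0 (vcol i j) j false (x (vcol i j) j))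
                     (frow s t i x J.+1)].
Proof.
have [p [q [E Hp Hq sp hq]]] := red_rows k_gt0 i x J.+1.
exists p, q; split=> //.
all: rewrite /relevant iter_cancel1 // (signature_rows k_gt0 V RY) // E filter_cat.
  rewrite (all_filterP Hp) (_ : filter _ q = [::]) ?cats0 //.
  by apply/eqP; rewrite -[_ == _]negbK -has_filter -all_predC.
rewrite (all_filterP Hq) (_ : filter _ p = [::]) //.
apply/eqP; rewrite -[_ == _]negbK -has_filter -all_predC.
by apply: sub_all Hp => c /= ->.
Qed.

Lemma etilde_None i : etilde i Y = None <-> excess s t i x J.+1 = 0%N.
Proof.
have [p [q [Ep _ <- _]]] := relevant_rows i.
rewrite /etilde Ep; case/lastP: p {Ep} => [//|p c].
by rewrite rev_rcons size_rcons.
Qed.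

Lemma ftilde_None i : frow s t i x J.+1 = None -> ftilde i Y = None.
Proof. by have [p [q [_ Eq _ E]]] := relevant_rows i; rewrite /ftilde Eq E => ->. Qed.

Lemma ftilde_Some i j : frow s t i x J.+1 = Some j -> (j < J)%N ->
  exists2 Y', ftilde i Y = Some Y' & realizes J (shift_entry 1 (vcol i j) j x) Y'.
Proof.
move=> fj jJ; have [_ [q [_ Eq _ E]]] := relevant_rows i.
have [_ fz _] := frowP fj.
rewrite /ftilde Eq E fj -[omap _ _]/(Some (corner_at k_gt0 (vcol i j) j false (x (vcol i j) j))).
set c := vcol i j.
have jhi : x c j < hi s t x c j by have := le_hi i j V; move: fz; rewrite /nzeros -/c; lia.
have jnxt : x c j < nxt s t x c j by move: jhi; rewrite /hi; case: (j); lia.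
have [l [a El]] : exists (l : 'I_(level Lam)) a, x c j = l%:Z - k%:Z * a.
  by exists (ordm k_gt0 (x c j)), (- (x c j %/ k%:Z)%Z); exact: ordm_split.
have Ec : corner_at k_gt0 c j false (x c j) = (l, (j, 2 * a + (c : nat)%:Z + 1, false)).
  by rewrite El corner_atE.
have := (rows_corner k_gt0 RY i j (x c j)).2.
rewrite -/c lexx jhi Ec => /(_ isT); rewrite [let _ := _ in _]/= mem_concave => /andP[/eqP Ee Hc].
set e := entry _ _ j in Ee.
have msz := concave_size Hc.
have [Rlt RG Rn] := RY.
exists (set_comp Y l j (e - 1)); first by rewrite -Ee; reflexivity.
split.
- move=> l'; rewrite ffunE; case: eqP => [->|_]; last exact: Rlt.
  by have [] := set_entryE (Rlt l) msz.
- move=> l' j' a' c'; rewrite ffunE.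
  (* Raising the entry by one changes the comparison only at the index [x c j] itself, which belongs
     to component [l]. *)
  case: (eqVneq l' l) => [->|l'l]; last first.
    rewrite RG /shift_entry; case: ifP => // /andP[/eqP -> /eqP ->].
    rewrite El -/k; have : l'%:Z - k%:Z * a' != l%:Z - k%:Z * a.
      by apply: contra l'l => /eqP Ell; rewrite -(ordmE k_gt0 l' a') Ell ordmE.
    by move: (l'%:Z - k%:Z * a') (l%:Z - k%:Z * a) => u v; lia.
  rewrite (entry_set_entry (Rlt l) msz); have [->|j'j] := eqVneq j' j; last first.
    by rewrite RG /shift_entry (negbTE j'j) andbF.
  rewrite -/e /shift_entry eqxx andbT; have [->|cc] := eqVneq c' c.
    rewrite El -Ee ltzD1 lerD2l lerN2 ler_pM2l; last by rewrite ltz_nat.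
    by lia.
  have := RG l j a' c'; rewrite -/e -Ee => <-.
  by case: c c' cc {E jhi jnxt El Ec Ee} => -[] //= _; lia.
- move=> i'.
  have -> : ncolor i' (set_comp Y l j (e - 1)) = (ncolor i' Y + (i' == i))%N.
    rewrite /ncolor (bigD1 l) //= [in RHS](bigD1 l) //= addnAC; congr addn.
      rewrite ffunE eqxx (count_set_entry (Rlt l) msz) /= -/e -Ee; congr (_ + _)%N.
      by congr nat_of_bool; rewrite /color /c /vcol; lia.
    by apply: eq_bigr => l' /negbTE l'l; rewrite ffunE l'l.
  rewrite PoszD Rn (bigD1 (Ordinal jJ)) //= [in RHS](bigD1 (Ordinal jJ)) //=.
  rewrite addrAC; congr (_ + _).
    rewrite /shift_entry eqxx andbT.
    have -> : (vcol i' j == c) = (i' == i) by rewrite /c /vcol; lia.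
    by case: eqP => [->|_] /=; rewrite ?addr0 // addrAC.
  apply: eq_bigr => n nj; rewrite /shift_entry ifF //; apply/negbTE.
  by rewrite negb_and; apply/orP; right; rewrite -val_eqE in nj.
Qed.

End Step.

(** * Demazure sets *)

(** If [w] does not begin with [i], the product is [i :: w], too long to be a subword of [w]. *)
Lemma bruhat_rmul i w : bruhat (rmul i w) w = (ohead w == Some i).
Proof.
have long j u : subseq (j :: u) u = false.
  by apply/negbTE/negP => /size_subseq; rewrite ltnn.
case: w => [//|j w] /=; case: eqVneq => [->|ij].
  rewrite eqxx /bruhat subseq_cons andbT; apply/eqP => /(congr1 size) /=; lia.
rewrite /bruhat long andbF; apply/esym/eqP => -[ji]; by rewrite ji eqxx in ij.
Qed.

Fixpoint alt (i : bool) (n : nat) : weyl :=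
  if n is m.+1 then i :: alt (~~ i) m else [::].

Lemma rmul_alt i n : rmul i (alt (~~ i) n) = alt i n.+1.
Proof. by case: n => //= n; case: i. Qed.

Lemma wplusE n : wplus n = alt (~~ odd n) n.
Proof. by elim: n => //= n ->; rewrite rmul_alt negbK. Qed.

Lemma wminusE n : wminus n = alt (odd n) n.
Proof. by elim: n => //= n ->; have := rmul_alt (~~ odd n) n; rewrite /= !negbK. Qed.

Lemma demazure_nil (Lam : domweight) (Y : eydtuple Lam) :
  demazure [::] Y -> Y = Phi Lam.
Proof.
move Ew: [::] => w D; case: D Ew => // i w' m b Y' + _ _ _ Ew.
by rewrite -Ew bruhat_rmul.
Qed.

Lemma demazure_cons (Lam : domweight) i w (Y : eydtuple Lam) :
  demazure (i :: w) Y -> exists m b, demazure w b /\ ftilde_iter i m b = Some Y.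
Proof.
move Ew: (i :: w) => w' D; case: D Ew => // i' {}w' m b Y' + D _ fb Ew.
rewrite -Ew bruhat_rmul /= => /eqP [ii']; exists m, b; split; last by rewrite ii'.
by rewrite -Ew -ii' /= eqxx in D.
Qed.

Lemma demazure_consI (Lam : domweight) i m w (b Y : eydtuple Lam) :
  demazure w b -> etilde i b = None -> ftilde_iter i m b = Some Y -> demazure (i :: w) Y.
Proof.
move=> D e f; apply: (demazure_step (i := i) _ _ e f); rewrite ?bruhat_rmul //=.
by rewrite eqxx.
Qed.

Section Demazure.
Variables s t : nat.
Let k : nat := (s + t)%N.
Hypothesis k_gt0 : (0 < k)%N.
Let Lam : domweight := (s, t).
Variable J : nat.

Lemma realizes_inj x (Y Y' : eydtuple Lam) :
  realizes J x Y -> realizes J x Y' -> Y = Y'.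
Proof.
move=> [lt R _] [lt' R' _]; apply/ffunP => l.
have E n : entry (charge l) (Y l) n = entry (charge l) (Y' l) n.
  have [a [c Ea]] := int_parity (entry (charge l) (Y l) n).
  have [a' [c' Ea']] := int_parity (entry (charge l) (Y' l) n).
  apply/eqP; rewrite eq_le {1}Ea' R -R' -Ea' lexx /=.
  by rewrite {1}Ea R' -R -Ea lexx.
have sz (y y' : eyd) : all (fun e => e < charge l) y ->
    entry (charge l) y =1 entry (charge l) y' -> (size y <= size y')%N.
  move=> ylt yy'; rewrite leqNgt; apply/negP => lts.
  have := allP ylt _ (mem_nth (charge l) lts).
  by have := yy' (size y'); rewrite /entry => ->; rewrite nth_default ?ltxx.
apply: (@eq_from_nth _ (charge l)) => [|n _]; last exact: E.
by apply/eqP; rewrite eqn_leq !sz.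
Qed.

(** Every integer has the form l - k * a, so the two states can be compared at the index [x' b n]
    itself. *)
Lemma realizes_le x x' (Y : eydtuple Lam) :
  realizes J x Y -> realizes J x' Y -> forall b n, x b n <= x' b n.
Proof.
move=> [_ R _] [_ R' _] b n; rewrite leNgt; apply/negP.
have [l [a El]] : exists (l : 'I_(level Lam)) a, x' b n = l%:Z - k%:Z * a.
  by exists (ordm k_gt0 (x' b n)), (- (x' b n %/ k%:Z)%Z); exact: ordm_split.
by rewrite [X in X < _]El -R R' -El ltxx.
Qed.

Lemma realizes_state_inj x x' (Y : eydtuple Lam) :
  realizes J x Y -> realizes J x' Y -> x = x'.
Proof.
move=> R R'; apply/funext => b; apply/funext => n; apply: le_anti.
by rewrite (realizes_le R R') (realizes_le R' R).
Qed.

Lemma realizes_Phi : realizes J (fun b _ => gnd s t b) (Phi Lam).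
Proof.
split=> [l|l j a c|i]; first by rewrite ffunE.
  rewrite ffunE /entry nth_nil /charge /gnd /=.
  have := ltn_ord l; rewrite [X in (_ < X)%N]/level /= -/k.
  move: (nat_of_ord l) => n nk.
  have [an|an] := lerP a (-1); first by case: c; case: ltnP => ?; nia.
  have [ap|ap] := lerP 1 a; first by case: c; case: ltnP => ?; nia.
  have -> : a = 0 by lia.
  by rewrite !mulr0; case: c; case: ltnP; lia.
rewrite big1 => [|j _]; last by rewrite subrr.
by rewrite /ncolor big1 // => l _; rewrite ffunE.
Qed.

Lemma realizes_ftilde_iter i L x m (b Y : eydtuple Lam) : (0 < L <= J)%N ->
  dstate s t i L x -> realizes J x b -> ftilde_iter i m b = Some Y ->
  exists2 x', dstate s t i L x' & realizes J x' Y.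
Proof.
move=> /andP[L0 LJ] D R; elim: m Y => [|m IH] Y /=; first by move=> [<-]; exists x.
rewrite /ftilde_iter /=; case E: (iter _ _ _) => [Y'|//] /= fY.
have [x' D' R'] := IH Y' E; have V' : valid s t x' by case: D'.
have gx b' n : (J <= n)%N -> x' b' n = gnd s t b' by move=> Jn; apply: dstate_gnd D' _; lia.
case Ef: (frow s t i x' J.+1) => [j|]; last by rewrite (ftilde_None k_gt0 V' R') in fY.
have jL := dstate_frow L0 D' Ef.
have [|Y''] := ftilde_Some k_gt0 V' R' gx Ef; first lia.
rewrite fY => -[<-] R''; exists (shift_entry 1 (vcol i j) j x') => //.
by apply: dstate_fshift Ef => //; lia.
Qed.

Lemma demazure_dstate L i (Y : eydtuple Lam) : (L <= J)%N -> demazure (alt i L) Y ->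
  exists2 x, dstate s t i L x & realizes J x Y.
Proof.
elim: L i Y => [|L IH] i Y LJ /=.
  move=> /demazure_nil ->; exists (fun b _ => gnd s t b); last exact: realizes_Phi.
  exact/dstate0.
move=> /demazure_cons [m [b [/IH [|x /dstateS D R fb]]]]; first lia.
by apply: realizes_ftilde_iter D R fb; lia.
Qed.

(** Surviving 1s are removed one at a time, by induction on [excess]; when none is left,
    [dstate_top] passes to the shorter word. By [erow_shift], the raising moves retrace the way
    back. *)
Lemma dstate_demazure L i x : (L <= J)%N -> dstate s t i L x ->
  exists2 Y : eydtuple Lam, demazure (alt i L) Y & realizes J x Y.
Proof.
elim: L i x => [|L IH] i x LJ.
  move=> /dstate0 E; exists (Phi Lam); first exact: demazure_id.
  suff -> : x = (fun b _ => gnd s t b) by exact: realizes_Phi.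
  by apply/funext => b; apply/funext => n.
suff H n : excess s t i x J.+1 = n -> dstate s t i L.+1 x -> exists m (b Y : eydtuple Lam),
    [/\ demazure (alt (~~ i) L) b, etilde i b = None, ftilde_iter i m b = Some Y & realizes J x Y].
  move=> /(H _ erefl) [m [b [Y [D e f R]]]]; exists Y => //.
  exact: demazure_consI D e f.
elim: n x => [|n IHn] x en D.
  have gx b n : (J <= n)%N -> x b n = gnd s t b by move=> Jn; apply: dstate_gnd D _; lia.
  have V : valid s t x by case: D.
  have [Y DY R] := IH (~~ i) x (ltnW LJ) (dstate_top (leqW LJ) D en).
  exists 0%N, Y, Y; split=> //.
  by apply/(etilde_None k_gt0 V R gx).
case Ee: (erow s t i x J.+1) => [j|]; last by rewrite (erow_excess Ee) in en.
have V : valid s t x by case: D.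
have jL := dstate_erow (ltn0Sn _) D Ee.
have D' := dstate_eshift (ltn0Sn _) D Ee.
have [Ef Ex] := erow_shift V Ee.
set x' := shift_entry _ _ _ _ in D' Ef Ex.
have V' : valid s t x' by case: D'.
have gx b' n' : (J <= n')%N -> x' b' n' = gnd s t b' by move=> Jn; apply: dstate_gnd D' _; lia.
have [m [b [Y [Db e f R]]]] := IHn x' ltac:(lia) D'.
have [|Y' fY R'] := ftilde_Some k_gt0 V' R gx Ef; first lia.
exists m.+1, b, Y'; split=> //; first by rewrite /ftilde_iter /= -/(ftilde_iter i m b) f.
suff -> : x = shift_entry 1 (vcol i j) j x' by [].
apply/funext => c; apply/funext => n'; rewrite /x' /shift_entry.
case: (_ && _) => //. by rewrite -addrA addNr addr0.
Qed.

End Demazure.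

Lemma fsum_reindex (R : nmodType) (I : finType) (T : choiceType) (P : pred I)
    (h : I -> T) (Q : set T) (F : T -> R) :
  (forall i, P i -> Q (h i)) ->
  (forall x, Q x -> exists2 i, P i & h i = x) ->
  {in P &, injective h} ->
  \sum_(x \in Q) F x = \sum_(i | P i) F (h i).
Proof.
move=> PQ QP inj.
rewrite (fsbigE [seq h i | i <- enum P]).
- rewrite big_map big_enum_cond /=; apply: eq_bigl => i.
  rewrite unfold_in; case Pi: (P i) => //=.
  by apply/mem_set/PQ.
- by rewrite map_inj_in_uniq ?enum_uniq // => i j; rewrite !mem_enum; apply: inj.
- by move=> x /= /mapP [i]; rewrite mem_enum => Pi ->; apply: PQ.
- move=> x /QP [i Pi <-] /negP []; apply/mapP; exists i => //.
  by rewrite mem_enum.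
Qed.

(** * Characters as sums over sequences *)

(* The steps of the path attached to the sequence [D] of the delta_j. *)
Definition pm (k : nat) (D : nat -> nat) (j : nat) : nat :=
  if odd j then D j else (k - D j)%N.

Lemma pm_le k D n : (D n <= k)%N -> (pm k D n <= k)%N.
Proof. by rewrite /pm; case: odd; rewrite ?leq_subr. Qed.

Section Extension.
Variables (k L : nat) (d : {ffun 'I_L.+1 -> 'I_k.+1}) (t : nat).

Definition ext (n : nat) : nat := if (n <= L)%N then nat_of_ord (d (inord n)) else t.

Lemma ext_le n : (t <= k)%N -> (ext n <= k)%N.
Proof. by rewrite /ext; case: ifP => // _ _; rewrite -ltnS. Qed.

Lemma ext_ord (n : 'I_L.+1) : ext n = d n.
Proof. by rewrite /ext -ltnS ltn_ord inord_val. Qed.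

Lemma ext_max : ext L = d ord_max.
Proof. exact: (ext_ord ord_max). Qed.

Lemma ext_gt n : (L < n)%N -> ext n = t.
Proof. by move=> Ln; rewrite /ext leqNgt Ln. Qed.

Lemma pm_ext_le n : (t <= k)%N -> (pm k ext n <= k)%N.
Proof. by move=> tk; apply: pm_le; apply: ext_le. Qed.

End Extension.

Section Paths.
Variables s t L : nat.
Let k : nat := (s + t)%N.
Let Lam : domweight := (s, t).

Lemma stepE m : (m <= k)%N -> step k m = (k%:Z - 2 * m%:Z, 2 * m%:Z - k%:Z).
Proof.
have H (w : weight) n : w *+ n = (w.1 *+ n, w.2 *+ n).
  by elim: n => [|n IH]; rewrite ?mulr0n // !mulrS IH.
by move=> mk; rewrite /step !H /hat0 /hat1 /fund /=; congr (_, _) => /=; lia.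
Qed.

Lemma groundE n : ground Lam n = if odd n then (t%:Z, s%:Z) else (s%:Z, t%:Z).
Proof.
have H (w : weight) m : w *+ m = (w.1 *+ m, w.2 *+ m).
  by elim: m => [|m IH]; rewrite ?mulr0n // !mulrS IH.
by rewrite /ground !H /fund /=; case: odd => /=; congr (_, _) => /=; lia.
Qed.

Lemma ground_step n : ground Lam n.+1 - ground Lam n = step k (if odd n then t else s).
Proof.
rewrite stepE; last by rewrite /k; case: ifP; lia.
by rewrite !groundE /=; case: odd => /=; congr (_, _) => /=; rewrite /k; lia.
Qed.

Lemma mu_step (p : nat -> weight) n m : (m <= k)%N -> p n.+1 - p n = step k m -> mu k p n = m.
Proof.
move=> mk E; rewrite /mu; case: pickP => [m' /eqP|/(_ (inord m))]; rewrite E.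
  have m'k : (m' <= k)%N by rewrite -ltnS.
  by rewrite !stepE // => -[]; lia.
by rewrite inordK ?eqxx.
Qed.

(** The end of a path is prescribed, so it is rebuilt backwards from there. *)
Definition path_of (D : nat -> nat) (j : nat) : weight :=
  ground Lam L.+1 - \sum_(j <= n < L.+1) step k (pm k D n).

Lemma path_of_step D j : (j <= L)%N ->
  path_of D j.+1 - path_of D j = step k (pm k D j).
Proof.
by move=> jL; rewrite /path_of [X in _ - (_ - X)]big_ltn // opprB addrC addrA subrK addrK.
Qed.

Definition path_tuple (D : nat -> nat) : L.+2.-tuple weight := [tuple path_of D i | i < L.+2].

Lemma path_tupleE D j : (j <= L.+1)%N -> (path_tuple D)`_j = path_of D j.
Proof.
by move=> jL; rewrite -[j]/(nat_of_ord (Ordinal (jL : (j < L.+2)%N))) -tnth_nth tnth_mktuple.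
Qed.

Lemma mu_path_tuple D n : (n <= L)%N -> (pm k D n <= k)%N ->
  mu k (nth 0 (path_tuple D)) n = pm k D n.
Proof. by move=> nL pk; apply: mu_step => //; rewrite !path_tupleE ?path_of_step //; lia. Qed.

Lemma path_tuple_inj t0 : (t0 <= k)%N ->
  injective (fun d : {ffun 'I_L.+1 -> 'I_k.+1} => path_tuple (ext d t0)).
Proof.
move=> tk d d' /= E; apply/ffunP => n; apply: val_inj => /=.
have nL : (n <= L)%N by rewrite -ltnS.
have := mu_path_tuple nL (pm_ext_le d (t := t0) n tk).
rewrite E mu_path_tuple ?pm_ext_le // /pm !ext_ord.
by case: odd => //; have := ltn_ord (d n); have := ltn_ord (d' n); lia.
Qed.

(** The path stops before the value [t0] occurs. Keeping [t0] free lets weights with different [t]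
    be summed over the same extension as the Demazure character. *)
Lemma ch_deltas (R : comUnitRingType) (z q : R) (t0 : nat) : (t0 <= k)%N ->
  ch z q L Lam = \sum_(d : {ffun 'I_L.+1 -> 'I_k.+1} | d ord_max == t :> nat)
    z ^ pairL1 (ground Lam 0 - path_of (ext d t0) 0)
    * q ^ energy L Lam (nth 0 (path_tuple (ext d t0))).
Proof.
move=> tk; rewrite /ch (fsum_reindex (P := fun d : {ffun 'I_L.+1 -> 'I_k.+1} => d ord_max == t :> nat)
    (h := fun d => path_tuple (ext d t0))).
- by apply: eq_bigr => d _; rewrite path_tupleE.
- move=> d /eqP dt; split.
  + move=> n nL; rewrite path_tupleE // /path_of /Pk.
    have : forall r, (\sum_(n <= m < r) step k (pm k (ext d t0) m)).1 +
        (\sum_(n <= m < r) step k (pm k (ext d t0) m)).2 = 0.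
      elim=> [|r IH]; first by rewrite big_geq.
      have [nr|rn] := leqP n r; last by rewrite big_geq.
      rewrite big_nat_recr // stepE ?pm_ext_le //.
      by move: IH; case: (bigop _ _ _) => a b /=; lia.
    move=> /(_ L.+1); rewrite groundE /level /=; case: odd => /=; lia.
  + move=> n nL; exists (pm k (ext d t0) n); rewrite ?pm_ext_le //.
    by rewrite !path_tupleE ?path_of_step //; lia.
  + rewrite path_tupleE //; have := path_of_step (ext d t0) (leqnn L).
    rewrite /path_of big_geq // subr0 /pm.
    have -> : (ext d t0 L = t)%N by rewrite ext_max.
    move=> E; rewrite -[LHS](subKr (ground Lam L.+1)) E.
    have -> : (k - t = s)%N by rewrite /k addnK.
    by rewrite -ground_step subKr.
  + by rewrite path_tupleE // /path_of big_geq // subr0.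
- move=> p [P1 P2 P3 P4].
  pose m n := mu k (nth (0 : weight) p) n.
  have P2' n : (n <= L)%N -> p`_n.+1 - p`_n = step k (m n) /\ (m n <= k)%N.
    by move=> /P2 [m' mk E]; rewrite /m (mu_step mk E).
  (* Passing between steps and delta_j is an involution on values at most [k], so [d] applies the
     formula of [pm] to the steps. *)
  pose d : {ffun 'I_L.+1 -> 'I_k.+1} := [ffun n : 'I_L.+1 => inord (if odd n then m n else k - m n)%N].
  have Em n : (n <= L)%N -> pm k (ext d t0) n = m n.
    move=> nL; have [_ mk] := P2' n nL.
    rewrite /pm /ext nL ffunE !inordK //; last by case: ifP; lia.
    by case: odd; lia.
  exists d.
    have [] := P2' L (leqnn L); rewrite P3 P4 ground_step => E mk.
    rewrite ffunE inordK /=; last by case: ifP; lia.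
    move: E; rewrite !stepE //; last by rewrite /k; case: ifP; lia.
    by rewrite /k; case: odd => -[]; lia.
  apply: eq_from_tnth => j; rewrite !(tnth_nth 0) path_tupleE; last by rewrite -ltnS.
  have : forall n, (n <= L.+1)%N -> path_of (ext d t0) (L.+1 - n) = p`_(L.+1 - n).
    elim=> [|n IH] nL; first by rewrite subn0 P4 /path_of big_geq // subr0.
    have := path_of_step (ext d t0) (_ : L.+1 - n.+1 <= L)%N => /(_ ltac:(lia)).
    have [] := P2' (L.+1 - n.+1)%N ltac:(lia).
    rewrite subnSK // -IH ?(ltnW nL) // Em; last by lia.
    move=> <- _ /(congr1 (fun w => path_of (ext d t0) (L.+1 - n) - w)).
    by rewrite !subKr.
  move=> /(_ (L.+1 - j)%N); rewrite subKn //; last by rewrite -ltnS.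
  by apply; apply: leq_subr.
- by move=> d d' _ _; apply: path_tuple_inj.
Qed.

End Paths.

(** * The exponents of [z] and [q] *)

Definition zexp (t : nat) (D : nat -> nat) (L : nat) : int :=
  \sum_(0 <= n < L) (if odd n then (D n)%:Z - t%:Z else t%:Z - (D n)%:Z).

(** For the constant sequence [t <= k], both arguments of the maximum equal [pm k (fun=> t) n.+1];
    the subtracted term is thus the ground local energy. *)
Definition qexp (k t : nat) (D : nat -> nat) (L : nat) : int :=
  \sum_(0 <= n < L) n.+1%:Z *
    ((maxn (k - pm k D n) (pm k D n.+1))%:Z - (pm k (fun=> t) n.+1)%:Z).

Section PathExponents.
Variables s t L : nat.
Let k : nat := (s + t)%N.
Let Lam : domweight := (s, t).
Variable D : nat -> nat.
Hypothesis Dk : forall n, (D n <= k)%N.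

Lemma pairL1_path : pairL1 (ground Lam 0 - path_of s t L D 0) = zexp t D L.+1.
Proof.
have H r : (ground Lam 0 - (ground Lam r - \sum_(0 <= n < r) step k (pm k D n))).2 = 2 * zexp t D r.
  rewrite /zexp; elim: r => [|r IH]; first by rewrite !big_geq // subr0 subrr.
  have := ground_step s t r; rewrite -/Lam -/k => /(canRL (subrK _)) ->.
  have sr : ((if odd r then t else s) <= k)%N by rewrite /k; case: odd; lia.
  rewrite !big_nat_recr // mulrDr -IH !stepE ?pm_le //.
  move: (bigop _ _ _) (ground Lam r) => [a1 a2] [b1 b2] /=; have := Dk r.
  by rewrite /pm /k; case: odd => /=; lia.
by rewrite /pairL1 H mulKz.
Qed.

Lemma energy_path : energy L Lam (nth 0 (path_tuple s t L D)) = qexp k t D L.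
Proof.
rewrite /energy /qexp big_add1 /= big_nat_cond [RHS]big_nat_cond.
apply: eq_bigr => n /andP[/andP[_ nL] _]; congr (_ * (_ - _)).
  rewrite /localH !mu_path_tuple ?pm_le //; lia.
have gm j : mu k (ground Lam) j = pm k (fun=> t) j.
  rewrite (mu_step _ (ground_step s t j)) /pm /k; first by rewrite addnK.
  by case: odd; lia.
rewrite /localH -[level _]/k !gm /pm /= /k; case: odd => /=; lia.
Qed.

End PathExponents.

Section DemazureExponents.
Variables s t L : nat.
Let k : nat := (s + t)%N.
Variable D : nat -> nat.
Hypothesis Dk : forall n, (D n <= k)%N.
Hypothesis DL : forall n, (L <= n)%N -> D n = t.

(* Truncated differences: at most one of the two is nonzero, which makes consecutive
   rows agree in one of their entries. *)
Definition state_of : state := fun b j =>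
  gnd s t b + (\sum_(j <= n < L) (if b then D n - D n.+1 else D n.+1 - D n))%N%:Z.

Lemma state_of_rec b j : (j < L)%N ->
  state_of b j = state_of b j.+1 + (if b then D j - D j.+1 else D j.+1 - D j)%N%:Z.
Proof. by move=> jL; rewrite /state_of big_ltn // PoszD addrA addrAC. Qed.

Lemma state_of_gnd b j : (L <= j)%N -> state_of b j = gnd s t b.
Proof. by move=> Lj; rewrite /state_of big_geq // addr0. Qed.

Lemma state_of_diff j : state_of true j - state_of false j = (D j)%:Z.
Proof.
have [Lj|jL] := leqP L j; first by rewrite !state_of_gnd // DL // /gnd; lia.
rewrite -(subKn (ltnW jL)); elim: (L - j)%N => [|n IH].
  by rewrite subn0 !state_of_gnd // DL // /gnd; lia.
have [nL|Ln] := ltnP n L; last first.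
  by have -> : (L - n.+1 = L - n)%N by lia.
move: IH; rewrite -(subnSK nL) !(@state_of_rec _ (L - n.+1)); lia.
Qed.

Lemma state_of_valid : valid s t state_of.
Proof.
split=> [j|b j|j].
- by have := state_of_diff j; have := Dk j; rewrite /k; lia.
- have [Lj|jL] := leqP L j; first by rewrite !state_of_gnd // ltnW.
  by rewrite (state_of_rec _ jL); lia.
- have [Lj|jL] := leqP L j; first by left; rewrite !state_of_gnd // leqW.
  by rewrite !(state_of_rec _ jL); lia.
Qed.

(** From row [j + 1] to row [j] both entries can only grow and one of them stays put, so the change
    of [D] tells which one grows and by how much. *)
Lemma valid_state_of x : valid s t x -> (forall b n, (L <= n)%N -> x b n = gnd s t b) ->
  (forall n, x true n - x false n = (D n)%:Z) -> x = state_of.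
Proof.
move=> [V1 V2 V3] gx xD; apply/funext => b; apply/funext => j.
have [Lj|jL] := leqP L j; first by rewrite gx // state_of_gnd.
rewrite -(subKn (ltnW jL)); elim: (L - j)%N b => [|n IH] b.
  by rewrite subn0 gx // state_of_gnd.
have [nL|Ln] := ltnP n L; last first.
  by have -> : (L - n.+1 = L - n)%N by lia.
have jL' : (L - n.+1 < L)%N by lia.
rewrite (state_of_rec _ jL'); move: IH; rewrite -(subnSK nL) => IH.
set j' := (L - n.+1)%N in IH *; rewrite -IH.
have := V3 j'; have := V2 true j'; have := V2 false j'; have := xD j'; have := xD j'.+1.
by case: b; lia.
Qed.

Let kexp (i : bool) : int := \sum_(j < L) (state_of (vcol i j) j - gnd s t (vcol i j)).

Lemma kexp_diff : kexp true - kexp false = zexp t D L.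
Proof.
rewrite /zexp big_mkord /kexp -sumrB; apply: eq_bigr => j _.
have := state_of_diff j; rewrite /vcol /gnd; case: odd => /=; lia.
Qed.

(* The color-0 part of row [j] is the sum over n > j of H_n minus its ground value, so
   summing over the rows produces the factor n. *)
Lemma kexp_q : kexp false = qexp k t D L.
Proof.
pose h n : int := (maxn (k - pm k D n) (pm k D n.+1))%:Z - (pm k (fun=> t) n.+1)%:Z.
have T j : (j <= L)%N -> state_of (vcol false j) j - gnd s t (vcol false j) = \sum_(j <= n < L) h n.
  move=> jL; rewrite -(subKn jL); elim: (L - j)%N => [|n IH].
    by rewrite subn0 state_of_gnd // subrr big_geq.
  have [nL|Ln] := ltnP n L; last by have -> : (L - n.+1 = L - n)%N by lia.
  have jL' : (L - n.+1 < L)%N by lia.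
  move: IH; rewrite -(subnSK nL) => IH; set j' := (L - n.+1)%N in IH jL' *.
  rewrite big_ltn // -IH (state_of_rec _ jL') vcolS /h.
  have := state_of_diff j'; have := state_of_diff j'.+1; have := Dk j'; have := Dk j'.+1.
  rewrite /pm /vcol /gnd /k /=; case: odd => /=; lia.
rewrite /kexp /qexp (eq_bigr (fun j : 'I_L => \sum_(j <= n < L) h n)) => [|j _];
  last by rewrite T // ltnW.
rewrite -(big_mkord predT (fun j => \sum_(j <= n < L) h n)) -/(h _).
rewrite -[RHS]/(\sum_(0 <= n < L) n.+1%:Z * h n).
elim: (L) => [|r IH]; first by rewrite !big_geq.
rewrite !big_nat_recr //= -IH [X in _ + (X + _)]big_geq // add0r.
rewrite (eq_big_nat _ _ (F2 := fun j => \sum_(j <= n < r) h n + h r)); last first.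
  by move=> j /andP[_ jr]; rewrite big_nat_recr //= ltnW.
rewrite big_split /= sumr_const_nat subn0 -addrA; congr (_ + _).
by rewrite -mulr_natl; lia.
Qed.

End DemazureExponents.

(** * The Demazure character as a sum over the delta_j *)

Definition within (b : bool) (t m : nat) : bool := if b then (t <= m)%N else (m <= t)%N.

Section DemazureSum.
Variables s t L : nat.
Let k : nat := (s + t)%N.
Hypothesis k_gt0 : (0 < k)%N.
Let Lam : domweight := (s, t).

(** The rows past [L] are trivial, so the condition left is that the fixed entry of row [L] be
    trivial: a truncated difference of [D L] and [t] vanishes. *)
Lemma dstate_state_of i D : (forall n, (D n <= k)%N) ->
  (forall n, (L < n)%N -> D n = t) ->
  dstate s t i L.+1 (state_of s t L.+1 D) <-> within (vcol i L) t (D L).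
Proof.
move=> Dk DL; have rec b := state_of_rec s t D b (ltnSn L).
rewrite /within; split=> [[_ _ /(_ L (leqnn _))]|H].
  by rewrite rec state_of_gnd // (DL L.+1) //; case: vcol => /=; lia.
split=> [|n Ln|n]; first exact: state_of_valid.
  by rewrite state_of_gnd.
rewrite ltnS leq_eqVlt => /orP[/eqP <-|Ln]; last by rewrite state_of_gnd.
by rewrite rec state_of_gnd // (DL L.+1) //; move: H; case: vcol => /=; lia.
Qed.

Lemma ch_dem_deltas (R : comUnitRingType) (z q : R) i :
  ch_dem z q (alt i L.+1) Lam =
  \sum_(d : {ffun 'I_L.+1 -> 'I_k.+1} | within (vcol i L) t (d ord_max))
     z ^ zexp t (ext d t) L.+1 * q ^ qexp k t (ext d t) L.+1.
Proof.
have tk : (t <= k)%N by rewrite /k leq_addl.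
have Dk (d : {ffun 'I_L.+1 -> 'I_k.+1}) n : (ext d t n <= k)%N by apply: ext_le.
have DL (d : {ffun 'I_L.+1 -> 'I_k.+1}) n : (L < n)%N -> ext d t n = t by apply: ext_gt.
pose x (d : {ffun 'I_L.+1 -> 'I_k.+1}) := state_of s t L.+1 (ext d t).
pose Q (d : {ffun 'I_L.+1 -> 'I_k.+1}) (Y : eydtuple Lam) :=
  demazure (alt i L.+1) Y /\ realizes L.+1 (x d) Y.
(* [dstate_demazure] only asserts that a tuple exists, so one is chosen; [Phi Lam] is the default
   when there is none. *)
pose h (d : {ffun 'I_L.+1 -> 'I_k.+1}) := xget (Phi Lam) [set Y | Q d Y]%classic.
have hP (d : {ffun 'I_L.+1 -> 'I_k.+1}) : within (vcol i L) t (d ord_max) -> Q d (h d).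
  rewrite -(ext_max d t) => /(dstate_state_of i (Dk d) (DL d)) D.
  apply: (@xgetPex _ _ [set Y | Q d Y]%classic).
  by have [Y] := dstate_demazure k_gt0 (leqnn L.+1) D; exists Y.
rewrite /ch_dem (fsum_reindex (h := h)
  (P := fun d : {ffun 'I_L.+1 -> 'I_k.+1} => within (vcol i L) t (d ord_max))).
- apply: eq_bigr => d /hP [_ [_ _ N]]; rewrite !N /x.
  by rewrite -(kexp_diff s (DL d)) -(kexp_q (Dk d) (DL d)).
- by move=> d /hP [].
- move=> Y /= DY; have [x' D' R'] := demazure_dstate k_gt0 (leqnn L.+1) DY.
  have [[V1 _ _] _ _] := D'.
  pose d : {ffun 'I_L.+1 -> 'I_k.+1} := [ffun n : 'I_L.+1 => inord `|x' true n - x' false n|%N].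
  have Ex : x' = x d.
    apply: valid_state_of => [|b n Ln|n]; [by case: D' | exact: dstate_gnd D' Ln |].
    have := V1 n; rewrite -/k /ext; case: leqP => nL H.
      by rewrite ffunE !inordK //; lia.
    by rewrite !(dstate_gnd _ D') // /gnd; lia.
  have dP : within (vcol i L) t (d ord_max).
    by rewrite -(ext_max d t); apply/(dstate_state_of i (Dk d) (DL d)); rewrite -/(x d) -Ex.
  exists d => //; have [_ RY] := hP d dP; apply: realizes_inj RY _; by rewrite -Ex.
- move=> d d' /hP [_ R1] /hP [_ R2] hh; rewrite hh in R1.
  have E := realizes_state_inj k_gt0 R1 R2.
  apply/ffunP => n; apply: val_inj => /=; rewrite -!(ext_ord _ t).
  have := state_of_diff s (DL d) n; have := state_of_diff s (DL d') n.
  by rewrite -/(x d) -/(x d') E; lia.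
Qed.

End DemazureSum.

(** * Splitting according to the last delta *)

Lemma zexpS t D n :
  zexp t D n.+1 = zexp t D n + (if odd n then (D n)%:Z - t%:Z else t%:Z - (D n)%:Z).
Proof. by rewrite /zexp big_nat_recr. Qed.

Lemma qexpS k t D n : qexp k t D n.+1 = qexp k t D n + n.+1%:Z *
  ((maxn (k - pm k D n) (pm k D n.+1))%:Z - (pm k (fun=> t) n.+1)%:Z).
Proof. by rewrite /qexp big_nat_recr. Qed.

Lemma zexp_shift t t' D L :
  zexp t D L = zexp t' D L + (odd L : nat)%:Z * (t%:Z - t'%:Z).
Proof.
elim: L => [|n IH]; first by rewrite /zexp !big_geq // mul0r addr0.
by rewrite !zexpS IH /=; case: odd => /=; lia.
Qed.

Lemma qexp_shift k t t' D L : (t <= k)%N -> (t' <= k)%N -> qexp k t D L =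
  qexp k t' D L + (if odd L then t'%:Z - t%:Z else t%:Z - t'%:Z) * (uphalf L)%:Z.
Proof.
move=> tk tk'; elim: L => [|n IH]; first by rewrite /qexp !big_geq // mulr0.
rewrite !qexpS IH /pm /=.
have : n./2.+1 = (uphalf n + ~~ odd n)%N by lia.
have : n.+1 = ((uphalf n).*2 + ~~ odd n)%N by lia.
move: (uphalf n) => m; case: (odd n) => /= -> ->; rewrite -?subzn //.
  by rewrite -muln2 addn0 PoszM; ring.
by rewrite -muln2 !PoszD PoszM; ring.
Qed.

(** Taking [D L] as ground value in place of [t] shifts the first [L] terms by [qexp_shift]; in the
    last term, [within] decides the maximum, and the two contributions combine. *)
Lemma qexp_last b k t D L : (t <= k)%N -> (D L <= k)%N -> D L.+1 = t ->
  within b t (D L) -> qexp k t D L.+1 = qexp k (D L) D L +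
    (if b then (L.+1 + eps L.+1)./2 * (D L - t) else (L.+1 - eps L.+1)./2 * (t - D L))%N%:Z.
Proof.
move=> tk Dk Dt; rewrite qexpS (@qexp_shift k t (D L)) // /pm /eps /= Dt /within.
have : uphalf L = (L./2 + odd L)%N by lia.
have : L = (L./2.*2 + odd L)%N by lia.
move: (D L) Dk (L./2) (odd L) => {Dt} m mk h o EL ->; rewrite EL => H.
have -> : uphalf (h.*2 + o + ~~ o) = h.+1 by lia.
have -> : ((h.*2 + o).+1 - ~~ o)./2 = (h + o)%N by lia.
set X := ((maxn _ _)%:Z - _).
have -> : X = (if o then if b then 0 else t%:Z - m%:Z else if b then m%:Z - t%:Z else 0).
  by rewrite /X; case: (o) (b) H => -[] /=; lia.
rewrite -addn1 -[h.+1]addn1 -muln2.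
case: o {EL X} b H => -[] H /=; rewrite !PoszM -!subzn // !PoszD ?PoszM; ring.
Qed.

Lemma ch_deltas_qexp (R : comUnitRingType) (z q : R) k L m t : (m <= k)%N -> (t <= k)%N ->
  ch z q L (k - m, m)%N = \sum_(d : {ffun 'I_L.+1 -> 'I_k.+1} | d ord_max == m :> nat)
     z ^ zexp m (ext d t) L.+1 * q ^ qexp k m (ext d t) L.
Proof.
move=> mk; rewrite -(subnK mk) addnK; move: (k - m)%N => s tk; rewrite (ch_deltas _ _ _ tk).
apply: eq_bigr => d _.
have Dk n : (ext d t n <= s + m)%N by apply: ext_le.
by rewrite (pairL1_path _ Dk) (energy_path _ Dk).
Qed.

Lemma ch_dem_split (R : comUnitRingType) (z q : R) (s t L : nat) i :
  z \is a GRing.unit -> q \is a GRing.unit -> (0 < s + t)%N ->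
  let k := (s + t)%N in let b := vcol i L in
  ch_dem z q (alt i L.+1) (s, t) =
  \sum_(0 <= m < k.+1 | within b t m)
     z ^ ((eps L.+1)%:Z * (t%:Z - m%:Z))
     * q ^ (if b then (L.+1 + eps L.+1)./2 * (m - t)
            else (L.+1 - eps L.+1)./2 * (t - m))%N%:Z
     * ch z q L (k - m, m)%N.
Proof.
move=> hz hq k_gt0 k b; have tk : (t <= k)%N by rewrite /k leq_addl.
rewrite (@ch_dem_deltas s t L k_gt0) big_mkord.
(* The sequences whose last entry is [m] are those of the paths of [ch z q L (k - m, m)]. *)
rewrite (partition_big (fun d : {ffun 'I_L.+1 -> 'I_k.+1} => d ord_max) (within b t)) //=.
apply: eq_bigr => m wm; have mk : (m <= k)%N by rewrite -ltnS.
rewrite (ch_deltas_qexp z q L mk tk) mulr_sumr; apply: eq_big => [d|d /andP[_ /eqP dm]].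
  by apply/andP/idP => [[_ /eqP ->]|/eqP/val_inj ->] //; rewrite eqxx.
have EL : ext d t L = m by rewrite ext_max dm.
rewrite (zexp_shift t m) (@qexp_last b) ?EL ?ext_gt //.
by rewrite !exprzDr // mulrACA mulrC.
Qed.

Theorem theorem5 (R : comUnitRingType) (z q : R)
    (hz : z \is a GRing.unit) (hq : q \is a GRing.unit)
    (s t k L : nat) (hk : k = (s + t)%N) (hk1 : (1 <= k)%N) (hL : (1 <= L)%N) :
  ch_plus z q L (s, t) =
    \sum_(0 <= i < s.+1)
       z ^ (- ((eps L)%:Z * (s - i)%N%:Z))
       * q ^ (((L + eps L)./2 * (s - i))%N%:Z)
       * ch z q L.-1 (LamI k i)
  /\
  ch_minus z q L (s, t) =
    \sum_(0 <= i < t.+1)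
       z ^ ((eps L)%:Z * (t - i)%N%:Z)
       * q ^ (((L - eps L)./2 * (t - i))%N%:Z)
       * ch z q L.-1 (LamI k (k - i)).
Proof.
case: L hL => [//|L] _; subst k; rewrite /ch_plus /ch_minus wplusE wminusE.
(* The rightmost letter is fixed, so the parities of the leftmost letter and of row [L] cancel: the
   entry moving there is u(1) for [wplus] and u(0) for [wminus]. *)
rewrite !ch_dem_split // /within (_ : vcol _ L = true); last by rewrite /vcol /=; lia.
rewrite (_ : vcol _ L = false); last by rewrite /vcol /=; lia.
split.
(* Here [m] runs from [t] to [k], and [i = k - m] reverses the order of summation. *)
- rewrite -(big_nat_widenl t 0 _ predT) // -[X in \sum_(X <= _ < _ | _) _]add0n big_addn -addSn addnK.
  rewrite [RHS]big_nat_rev; apply: eq_big_nat => m /andP[_ ms].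
  have sm : (s - (s - m) = m)%N by lia.
  rewrite add0n subSS /LamI /= sm addnK.
  congr (_ ^ _ * _ * ch z q L (_, _)); [by rewrite PoszD; ring|lia|lia].
- rewrite -(big_nat_widen 0 t.+1 _ predT); last by rewrite ltnS leq_addl.
  apply: eq_big_nat => m /andP[_ mt].
  rewrite /LamI /= -!subzn //.
  congr (_ * ch z q L (_, _)); lia.
Qed.
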